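(* Let $-\infty<a<b<\infty$, $n\in\mathbb{N}$, $\alpha>0$ with $n-1<\alpha<n$, $0\le\beta\le1$, and let $\psi\in C^n[a,b]$ be real-valued and increasing with $\psi'(x)\neq0$ for all $x\in[a,b]$. If $f\in C^1[a,b]$, then $$ {}^{H}\mathbb{D}_{a+}^{\alpha,\beta;\psi}I_{a+}^{\alpha;\psi}f(x)=f(x)\quad\text{and}\quad {}^{H}\mathbb{D}_{b-}^{\alpha,\beta;\psi}I_{b-}^{\alpha;\psi}f(x)=f(x). $$
   Context: For $\mu>0$: $I_{a+}^{\mu;\psi}f(x)=\frac{1}{\Gamma(\mu)}\int_a^x\psi'(t)(\psi(x)-\psi(t))^{\mu-1}f(t)\,dt$ ($x>a$) and $I_{b-}^{\mu;\psi}f(x)=\frac{1}{\Gamma(\mu)}\int_x^b\psi'(t)(\psi(t)-\psi(x))^{\mu-1}f(t)\,dt$ ($x<b$); for $\mu=0$ these are the identity. The $\psi$-Hilfer fractional derivatives of order $\alpha$ and type $\beta$ are ${}^{H}\mathbb{D}_{a+}^{\alpha,\beta;\psi}h=I_{a+}^{\beta(n-\alpha);\psi}\left(\frac{1}{\psi'}\frac{d}{dx}\right)^nI_{a+}^{(1-\beta)(n-\alpha);\psi}h$ (for $x\in(a,b]$) and ${}^{H}\mathbb{D}_{b-}^{\alpha,\beta;\psi}h=I_{b-}^{\beta(n-\alpha);\psi}\left(-\frac{1}{\psi'}\frac{d}{dx}\right)^nI_{b-}^{(1-\beta)(n-\alpha);\psi}h$ (for $x\in[a,b)$). *)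

(* Defs.v *)
From HB Require Import structures.
From mathcomp Require Import all_boot all_order all_algebra.
From mathcomp Require Import all_classical all_reals all_analysis.
Set Implicit Arguments.
Unset Strict Implicit.
Unset Printing Implicit Defensive.
Import Order.TTheory GRing.Theory Num.Theory.
Import numFieldNormedType.Exports.
Local Open Scope classical_set_scope.
Local Open Scope ring_scope.

Section RelativeDerivative.
Context {R : realType}.
Implicit Types (A : set R) (f : R -> R) (x : R).

Definition diff_quotient f x (y : R) : R := (f y - f x) / (y - x).

(* Only the values of [f] on [A] matter; when [A] is an interval this is the
   usual derivative at interior points and the one-sided derivative at an
   endpoint belonging to [A]. *)
Definition derivable_on A f x : Prop :=
  cvg (diff_quotient f x y @[y --> within A x^']).

Definition derive_on A f x : R :=
  lim (diff_quotient f x y @[y --> within A x^']).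

Definition derive_onn A (k : nat) f : R -> R := iter k (derive_on A) f.

Definition Cn_on (n : nat) A f : Prop :=
  (forall k, (k < n)%N ->
     forall x, A x -> derivable_on A (derive_onn A k f) x) /\
  (forall k, (k <= n)%N -> {within A, continuous (derive_onn A k f)}).

End RelativeDerivative.

Definition Gamma {R : realType} (mu : R) : R :=
  \int[lebesgue_measure]_(t in `]0, +oo[) (t `^ (mu - 1) * expR (- t)).

(* The operators below are total functions; a predicate with suffix [_defined]
   states that the integrals and derivatives entering an operator exist. *)
Section PsiFractional.
Context {R : realType}.
Variables (a b : R) (psi : R -> R).
Implicit Types (mu alpha beta : R) (h : R -> R) (x : R).

Local Notation psi' := (derive_on `[a, b] psi).

Definition left_integrand mu h x (t : R) : R :=
  psi' t * (psi x - psi t) `^ (mu - 1) * h t.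

Definition right_integrand mu h x (t : R) : R :=
  psi' t * (psi t - psi x) `^ (mu - 1) * h t.

Definition left_psi_integral mu h x : R :=
  if mu == 0 then h x
  else (Gamma mu)^-1 *
       \int[lebesgue_measure]_(t in `]a, x[) left_integrand mu h x t.

Definition right_psi_integral mu h x : R :=
  if mu == 0 then h x
  else (Gamma mu)^-1 *
       \int[lebesgue_measure]_(t in `]x, b[) right_integrand mu h x t.

Definition left_psi_integral_defined mu h x : Prop :=
  mu != 0 ->
  lebesgue_measure.-integrable `]a, x[ (EFin \o left_integrand mu h x).

Definition right_psi_integral_defined mu h x : Prop :=
  mu != 0 ->
  lebesgue_measure.-integrable `]x, b[ (EFin \o right_integrand mu h x).

(* Derivatives are relative to the half-open interval on which the operand is
   defined, hence one-sided at its closed end. *)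
Definition left_psi_derive h x : R := derive_on `]a, b] h x / psi' x.

Definition right_psi_derive h x : R := - (derive_on `[a, b[ h x / psi' x).

Definition left_psi_deriven (n : nat) h : R -> R := iter n left_psi_derive h.

Definition right_psi_deriven (n : nat) h : R -> R := iter n right_psi_derive h.

(* [n] is the integer with [n - 1 < alpha < n]. *)
Definition left_hilfer (n : nat) alpha beta h : R -> R :=
  left_psi_integral (beta * (n%:R - alpha))
    (left_psi_deriven n
      (left_psi_integral ((1 - beta) * (n%:R - alpha)) h)).

Definition right_hilfer (n : nat) alpha beta h : R -> R :=
  right_psi_integral (beta * (n%:R - alpha))
    (right_psi_deriven n
      (right_psi_integral ((1 - beta) * (n%:R - alpha)) h)).

Definition left_hilfer_defined (n : nat) alpha beta h x : Prop :=
  let g := left_psi_integral ((1 - beta) * (n%:R - alpha)) h in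
  [/\ forall y, y \in `]a, b] ->
        left_psi_integral_defined ((1 - beta) * (n%:R - alpha)) h y,
      forall k, (k < n)%N -> forall y, y \in `]a, b] ->
        derivable_on `]a, b] (left_psi_deriven k g) y
    & left_psi_integral_defined (beta * (n%:R - alpha))
        (left_psi_deriven n g) x].

Definition right_hilfer_defined (n : nat) alpha beta h x : Prop :=
  let g := right_psi_integral ((1 - beta) * (n%:R - alpha)) h in
  [/\ forall y, y \in `[a, b[ ->
        right_psi_integral_defined ((1 - beta) * (n%:R - alpha)) h y,
      forall k, (k < n)%N -> forall y, y \in `[a, b[ ->
        derivable_on `[a, b[ (right_psi_deriven k g) y
    & right_psi_integral_defined (beta * (n%:R - alpha))
        (right_psi_deriven n g) x].

End PsiFractional.

(* Main.v *)
(* The substitutions u = psi t - psi a (left) and u = psi b - psi t (right) turn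
   both pairs of operators into the Riemann-Liouville integrals
   I^p H = k_p * H on ]0, +oo[, where k_p u = u^(p-1) / Gamma p, and d/du.  Put
   d = beta (n - alpha), so 0 <= d < 1.  Associativity of convolution and
   k_p * k_q = k_(p+q) give I^p I^q = I^(p+q), so the outcome of the two inner
   integrations is I^(n-d) f, and n - 1 derivatives reduce it to I^(1-d) f.
   Writing f = f(0) + I^1 f', the last derivative is
   f(0) k_(1-d) + I^(1-d) f', and I^d sends it to f(0) + I^1 f' = f.  That
   k_p * k_q = c k_(p+q) is homogeneity; the constant c = 1 comes from
   integrating against exp(-u), which is multiplicative on convolutions. *)
Require Import Defs.
From mathcomp Require Import all_boot all_order all_algebra.
From mathcomp Require Import all_classical all_reals all_analysis.
From mathcomp Require Import measurable_realfun exponential_distribution.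
From mathcomp Require Import ring lra.
Set Implicit Arguments.
Unset Strict Implicit.
Unset Printing Implicit Defensive.
Import Order.TTheory GRing.Theory Num.Theory.
Import numFieldNormedType.Exports.
Local Open Scope classical_set_scope.
Local Open Scope ring_scope.

(** * Substitution on open intervals *)

(** Associativity of convolution is Tonelli's theorem, so it is proved for functions with values in
    [0, +oo], where no integrability has to be tracked. Signed functions come back as differences H
    = |H| - (|H| - H), whose two terms are nonnegative and continuous wherever H is. The last
    derivative cannot follow the pattern of the others: I^(p+1) differentiates to I^p only for p >
    0, and the order left over would be -d. This is where f in C^1 enters; the announced derivative
    is verified by integrating it back. For d > 0 the term f(0) k_(1-d) is in general unbounded at
    0, so the lemmas that must accept it assume continuity on ]0, +oo[ and integrability in place of
    boundedness near 0. If d or (1 - beta)(n - alpha) vanishes, the operator of that order is the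
    identity by convention and not a kernel integral, whence the case distinctions. Left and right
    operators share one argument: it is carried out for an abstract substitution [th], of which the
    two sides are instances. *)

Section Substitution.
Context {R : realType}.
Local Notation mu := (@lebesgue_measure R).

(** Monotone convergence on both sides: the two integrals are limits of the same sequence. It lifts
    a substitution rule from compact intervals to their union. *)
Lemma ge0_eq_integral_bigcup (I J : (set R)^nat) (g h : R -> \bar R) :
  nondecreasing_seq I -> nondecreasing_seq J ->
  (forall n, measurable (I n)) -> (forall n, measurable (J n)) ->
  (forall n, measurable_fun (I n) g) -> (forall n, measurable_fun (J n) h) ->
  (forall n x, I n x -> 0 <= g x)%E -> (forall n x, J n x -> 0 <= h x)%E ->
  (forall n, \int[mu]_(x in I n) g x = \int[mu]_(x in J n) h x)%E ->
  (\int[mu]_(x in \bigcup_n I n) g x = \int[mu]_(x in \bigcup_n J n) h x)%E.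
Proof.
move=> ndI ndJ mI mJ mg mh g0 h0 E.
have cg := ge0_nondecreasing_set_cvg_integral (mu := mu) ndI mI mg g0.
have ch := ge0_nondecreasing_set_cvg_integral (mu := mu) ndJ mJ mh h0.
have EE : (fun n => \int[mu]_(x in I n) g x)%E = (fun n =>
  \int[mu]_(x in J n) h x)%E.
  exact/funext.
by rewrite EE in cg; apply: (cvg_unique _ cg ch).
Qed.

(* The substitution rules of the library require the integrand to be continuous
   on a closed interval; here it may blow up at the ends of ]a, b[, so ]a, b[ is
   exhausted by the compact intervals [inner_lo a b n, inner_hi a b n]. *)
Definition inner_lo (a b : R) (n : nat) : R := a + (b - a) / n.+3%:R.
Definition inner_hi (a b : R) (n : nat) : R := b - (b - a) / n.+3%:R.

Lemma inner_bounds (a b : R) n : a < b ->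
  [/\ a < inner_lo a b n, inner_lo a b n < inner_hi a b n & inner_hi a b n < b].
Proof.
move=> ab; rewrite /inner_lo /inner_hi; have n0 : 0 < n.+3%:R :> R by
  rewrite ltr0n.
have d0 : 0 < (b - a) / n.+3%:R by rewrite divr_gt0// subr_gt0.
(* The offset 3 keeps the margin below half of the length already for [n = 0], so that the inner
   interval never degenerates. *)
have d1 : (b - a) / n.+3%:R < (b - a) / 2.
  by rewrite ltr_pM2l ?subr_gt0// ltf_pV2 ?posrE// ltr_nat.
by move: d0 d1; set d := _ / n.+3%:R => d0 d1; split; lra.
Qed.

Lemma inner_le (a b : R) m n : a < b -> (m <= n)%N ->
  inner_lo a b n <= inner_lo a b m /\ inner_hi a b m <= inner_hi a b n.
Proof.
move=> ab mn; rewrite /inner_lo /inner_hi.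
have d1 : (b - a) / n.+3%:R <= (b - a) / m.+3%:R.
  by rewrite ler_pM2l ?subr_gt0// lef_pV2 ?posrE ?ltr0n// ler_nat !ltnS.
by move: d1; set d := _ / n.+3%:R; set d' := _ / m.+3%:R => d1; split; lra.
Qed.

Lemma bigcup_inner (a b : R) : a < b ->
  \bigcup_n `[inner_lo a b n, inner_hi a b n]%classic = `]a, b[%classic.
Proof.
move=> ab; apply/seteqP; split => [x [n _]|x] /=; rewrite !in_itv/=.
  have [l _ h] := inner_bounds n ab => /andP[xl xh].
  by rewrite (lt_le_trans l xl) (le_lt_trans xh h).
move=> /andP[ax xb].
pose e := Num.min (x - a) (b - x).
have e0 : 0 < e by rewrite lt_min !subr_gt0 ax.
pose n := Num.bound ((b - a) / e).
have nP : (b - a) / e < n%:R.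
  by rewrite archi_boundP// ltW// divr_gt0// subr_gt0.
have H : (b - a) / n.+3%:R <= e.
  rewrite ler_pdivrMr ?ltr0n// mulrC -ler_pdivrMr//.
  apply: (le_trans (ltW nP)); rewrite ler_nat;
    exact: leq_trans (leqnSn _) (leq_trans (leqnSn _) (leqnSn _)).
exists n => //=; rewrite in_itv/= /inner_lo /inner_hi.
move: H; set d := _ / n.+3%:R => H.
have : e <= x - a /\ e <= b - x by split; rewrite ge_min lexx ?orbT.
by case; move=> ? ?; apply/andP; split; lra.
Qed.

Section increasing_or_decreasing.
Variables (F w G : R -> R) (a b : R).
Hypothesis ab : a < b.
Hypothesis dF : forall t, t \in `]a, b[ -> is_derive t 1 F (w t).
Hypothesis cw : forall t, t \in `]a, b[ -> {for t, continuous w}.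
Hypothesis cG : forall t, t \in `]a, b[ -> {for F t, continuous G}.
Hypothesis G0 : forall t, t \in `]a, b[ -> 0 <= G (F t).

Local Notation lo := (inner_lo a b).
Local Notation hi := (inner_hi a b).

Lemma derive1_oo t : t \in `]a, b[ -> (derive1 F) t = w t.
Proof. by move=> /dF dFt; rewrite derive1E derive_val. Qed.

Lemma continuous_derive1_oo t : t \in `]a, b[ -> {for t, continuous (derive1 F)}.
Proof.
move=> tab; rewrite /prop_for /continuous_at derive1_oo//.
apply: cvg_trans (cw tab); apply: near_eq_cvg.
by near=> s; rewrite derive1_oo//; near: s; exact: near_in_itvoo.
Unshelve. all: by end_near. Qed.

Lemma continuous_oo t : t \in `]a, b[ -> {for t, continuous F}.
Proof.
by move=> /dF dFt; apply: differentiable_continuous; apply/derivable1_diffP.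
Qed.

Lemma inner_mem n t : t \in `[lo n, hi n] -> t \in `]a, b[.
Proof.
rewrite !in_itv/=; have [l _ h] := inner_bounds n ab => /andP[xl xh].
by rewrite (lt_le_trans l xl) (le_lt_trans xh h).
Qed.

Lemma inner_derivable n : derivable_oo_LRcontinuous F (lo n) (hi n).
Proof.
have [l lh h] := inner_bounds n ab; split.
- by move=> t tn; have /dF : t \in `]a, b[
    by apply: (@inner_mem n); exact: subset_itv_oo_cc tn.
- apply: cvg_at_right_filter; apply: continuous_oo; apply: (@inner_mem n).
  by rewrite bound_itvE ltW.
- apply: cvg_at_left_filter; apply: continuous_oo; apply: (@inner_mem n).
  by rewrite bound_itvE ltW.
Qed.

Lemma inner_continuous n : {within `[lo n, hi n], continuous F}.
Proof. exact: derivable_oo_LRcontinuous_within (inner_derivable n). Qed.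

Lemma inner_cvg_lo n : cvg (derive1 F x @[x --> (lo n)^'+]).
Proof.
have [l lh h] := inner_bounds n ab; apply/cvg_ex; exists ((derive1 F) (lo n)).
apply: cvg_at_right_filter; apply: continuous_derive1_oo; apply: (@inner_mem n).
by rewrite bound_itvE ltW.
Qed.

Lemma inner_cvg_hi n : cvg (derive1 F x @[x --> (hi n)^'-]).
Proof.
have [l lh h] := inner_bounds n ab; apply/cvg_ex; exists ((derive1 F) (hi n)).
apply: cvg_at_left_filter; apply: continuous_derive1_oo; apply: (@inner_mem n).
by rewrite bound_itvE ltW.
Qed.

Lemma inner_measurable_comp n :
  measurable_fun `[lo n, hi n] (fun t => (G (F t) * w t)%:E).
Proof.
apply/measurable_EFinP; apply: subspace_continuous_measurable_fun => //.
apply: continuous_in_subspaceT => t /set_mem/= /inner_mem tab.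
apply: cvgM; last exact: cw.
apply: continuous_comp; [exact: continuous_oo|exact: cG].
Qed.

(** On each inner interval all data are continuous and the compact rule applies; the images of the
    inner intervals exhaust the image of ]a, b[. Nothing is known of [F] at the ends, so the range
    is stated as an image and not by its endpoints. *)
Lemma ge0_substitution_increasing_oo :
  {in `]a, b[ &, {homo F : x y / x < y}} ->
  (forall t, t \in `]a, b[ -> 0 <= w t) ->
  (\int[mu]_(x in F @` `]a, b[) (G x)%:E =
   \int[mu]_(t in `]a, b[) (G (F t) * w t)%:E)%E.
Proof.
move=> homoF w0.
have homon n : {in `[lo n, hi n] &, {homo F : x y / x < y}}.
  by move=> x y xn yn; apply: homoF; exact: (@inner_mem n).
have lehi n : lo n <= hi n by have [_ /ltW] := inner_bounds n ab.
have [loin hiin] : (forall n, lo n \in `[lo n, hi n]) /\ (forall n, hi n \in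
  `[lo n, hi n]).
  by split=> n; rewrite bound_itvE.
have leF n : {in `[lo n, hi n] &, {homo F : x y / x <= y}}.
  by apply: ltW_homo_in; exact: homon.
have imF n : F @` `[lo n, hi n] = `[F (lo n), F (hi n)]%classic.
  apply/seteqP; split => [_ [t /= tn <-]|s /=].
    rewrite in_itv/=; move: (tn); rewrite in_itv/= => /andP[l h].
    by rewrite !(leF n).
  rewrite in_itv/= => /andP[l h].
  have Fl : F (lo n) <= F (hi n) by apply: (leF n).
  by case: (@IVT R F _ _ s (lehi n) (@inner_continuous n));
    [rewrite min_l// max_r// l h|move=> c cn <-; exists c].
have cGn n s : `[F (lo n), F (hi n)]%classic s -> {for s, continuous G} /\ 0 <=
  G s.
  by rewrite -imF => -[t /inner_mem tab <-]; split; [exact: cG|exact: G0].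
rewrite -(bigcup_inner ab) image_bigcup.
under eq_bigcupr => n _ do rewrite imF.
apply: ge0_eq_integral_bigcup.
- move=> m n mn; apply/subsetPset => s /=; rewrite !in_itv/= => /andP[l h].
  have [? ?] := inner_le ab mn.
  have h1 : lo m \in `[lo n, hi n] by rewrite in_itv/=; apply/andP; split=> //;
    apply: le_trans (lehi m) _.
  have h2 : hi m \in `[lo n, hi n] by rewrite in_itv/=; apply/andP; split=> //;
    apply: le_trans (lehi m).
  by apply/andP; split; [apply: le_trans l|apply: (le_trans h)]; apply: (leF n).
- move=> m n mn; apply/subsetPset => s /=; rewrite !in_itv/= => /andP[l h].
  have [? ?] := inner_le ab mn.
  by apply/andP; split; [apply: le_trans l|apply: (le_trans h)].
- by move=> n; exact: measurable_itv.
- by move=> n; exact: measurable_itv.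
- move=> n; apply/measurable_EFinP; apply: subspace_continuous_measurable_fun
    => //.
  by apply: continuous_in_subspaceT => s /set_mem/cGn[].
- exact: inner_measurable_comp.
- by move=> n s /cGn[_]; rewrite lee_fin.
- by move=> n t /inner_mem tab; rewrite lee_fin mulr_ge0 ?G0 ?w0.
move=> n; rewrite integration_by_substitution_increasing//.
- apply: eq_integral => t /set_mem/= /inner_mem tab.
  by rewrite /= -derive1_oo.
- by move=> t tn; apply: continuous_derive1_oo; apply: (@inner_mem n);
    exact: subset_itv_oo_cc tn.
- exact: inner_cvg_lo.
- exact: inner_cvg_hi.
- exact: inner_derivable.
- by apply: continuous_in_subspaceT => s /set_mem/cGn[].
Qed.

Lemma ge0_substitution_decreasing_oo :
  {in `]a, b[ &, {homo F : x y /~ x < y}} ->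
  (forall t, t \in `]a, b[ -> w t <= 0) ->
  (\int[mu]_(x in F @` `]a, b[) (G x)%:E =
   \int[mu]_(t in `]a, b[) (G (F t) * - w t)%:E)%E.
Proof.
move=> homoF w0.
have homon n : {in `[lo n, hi n] &, {homo F : x y /~ x < y}}.
  by move=> x y xn yn; apply: homoF; exact: (@inner_mem n).
have lehi n : lo n <= hi n by have [_ /ltW] := inner_bounds n ab.
have [loin hiin] : (forall n, lo n \in `[lo n, hi n]) /\ (forall n, hi n \in
  `[lo n, hi n]).
  by split=> n; rewrite bound_itvE.
have leF n : {in `[lo n, hi n] &, {homo F : x y /~ x <= y}}.
  by apply: ltW_nhomo_in; exact: homon.
have imF n : F @` `[lo n, hi n] = `[F (hi n), F (lo n)]%classic.
  apply/seteqP; split => [_ [t /= tn <-]|s /=].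
    rewrite in_itv/=; move: (tn); rewrite in_itv/= => /andP[l h].
    by rewrite !(leF n).
  rewrite in_itv/= => /andP[l h].
  have Fl : F (hi n) <= F (lo n) by apply: (leF n).
  by case: (@IVT R F _ _ s (lehi n) (@inner_continuous n));
    [rewrite min_r// max_l// l h|move=> c cn <-; exists c].
have cGn n s : `[F (hi n), F (lo n)]%classic s -> {for s, continuous G} /\ 0 <=
  G s.
  by rewrite -imF => -[t /inner_mem tab <-]; split; [exact: cG|exact: G0].
rewrite -(bigcup_inner ab) image_bigcup.
under eq_bigcupr => n _ do rewrite imF.
apply: ge0_eq_integral_bigcup.
- move=> m n mn; apply/subsetPset => s /=; rewrite !in_itv/= => /andP[l h].
  have [? ?] := inner_le ab mn.
  have h1 : lo m \in `[lo n, hi n] by rewrite in_itv/=; apply/andP; split=> //;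
    apply: le_trans (lehi m) _.
  have h2 : hi m \in `[lo n, hi n] by rewrite in_itv/=; apply/andP; split=> //;
    apply: le_trans (lehi m).
  by apply/andP; split; [apply: le_trans l|apply: (le_trans h)]; apply: (leF n).
- move=> m n mn; apply/subsetPset => s /=; rewrite !in_itv/= => /andP[l h].
  have [? ?] := inner_le ab mn.
  by apply/andP; split; [apply: le_trans l|apply: (le_trans h)].
- by move=> n; exact: measurable_itv.
- by move=> n; exact: measurable_itv.
- move=> n; apply/measurable_EFinP; apply: subspace_continuous_measurable_fun
    => //.
  by apply: continuous_in_subspaceT => s /set_mem/cGn[].
- move=> n; rewrite (_ : (fun t => _) = \- (fun t => (G (F t) * w t)%:E))%E;
    last first.
    by apply/funext => t; rewrite mulrN EFinN.
  by apply: measurableT_comp => //; exact: inner_measurable_comp.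
- by move=> n s /cGn[_]; rewrite lee_fin.
- by move=> n t /inner_mem tab; rewrite lee_fin mulr_ge0 ?G0 ?oppr_ge0 ?w0.
move=> n; rewrite integration_by_substitution_decreasing//.
- apply: eq_integral => t /set_mem/= /inner_mem tab.
  by rewrite /= -derive1_oo.
- by move=> t tn; apply: continuous_derive1_oo; apply: (@inner_mem n);
    exact: subset_itv_oo_cc tn.
- exact: inner_cvg_lo.
- exact: inner_cvg_hi.
- exact: inner_derivable.
- by apply: continuous_in_subspaceT => s /set_mem/cGn[].
Qed.

End increasing_or_decreasing.
End Substitution.

(** * Convolution and the Beta integral *)

Section Convolution.
Context {R : realType}.
Local Notation mu := (@lebesgue_measure R).
Local Open Scope ereal_scope.
Implicit Types f g h : R -> \bar R.

(** The image of Lebesgue measure under a translation gives every half-open interval its length,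
    hence is Lebesgue measure by uniqueness. *)
Lemma ge0_integral_shift f (c : R) : measurable_fun [set: R] f ->
  (forall x, 0 <= f x) -> \int[mu]_x f (x + c)%R = \int[mu]_x f x.
Proof.
move=> mf f0; pose sh (x : measurableTypeR R) : measurableTypeR R := (x + c)%R.
have msh : measurable_fun [set: measurableTypeR R] sh by exact: measurable_funD.
have E := @ge0_integral_pushforward _ _ (measurableTypeR R) (measurableTypeR R)
  R sh msh mu setT f measurableT mf (fun _ _ => f0 _).
rewrite preimage_setT in E.
transitivity (\int[pushforward mu sh]_y f y); first by rewrite E.
apply: eq_measure_integral => A mA _; apply/esym.
apply: lebesgue_measure_unique => //= _ [[a b]] _ <-.
rewrite /pushforward.
rewrite (_ : _ @^-1` _ = `](a - c)%R, (b - c)%R]%classic); last first.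
  by apply/seteqP; split=> x /=; rewrite !in_itv/= /sh; move=> /andP[? ?];
    apply/andP; split; lra.
rewrite !lebesgue_measure_itv/= !lte_fin ltrD2r.
by case: ifP => // _; rewrite -!EFinB; congr EFin; ring.
Qed.

(** Integration runs over the whole line; the range ]0, y[ of the fractional integrals results from
    arguments that vanish outside ]0, +oo[. *)
Definition conv f g (y : R) : \bar R := \int[mu]_u (f (y - u)%R * g u).

Lemma measurable_fun_sub2 f : measurable_fun [set: R] f ->
  measurable_fun [set: R * R] (fun z : R * R => f (z.1 - z.2)%R).
Proof.
by move=> mf; apply: measurableT_comp => //; apply: measurable_funB;
  [exact: measurable_fst|exact: measurable_snd].
Qed.

Lemma measurable_fun_subr f c : measurable_fun [set: R] f ->
  measurable_fun [set: R] (fun u : R => f (u - c)%R).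
Proof. by move=> mf; apply: measurableT_comp => //; exact: measurable_funB. Qed.

Lemma measurable_fun_subl f c : measurable_fun [set: R] f ->
  measurable_fun [set: R] (fun u : R => f (c - u)%R).
Proof. by move=> mf; apply: measurableT_comp => //; exact: measurable_funB. Qed.

Section nonneg.
Variables f g : R -> \bar R.
Hypotheses (mf : measurable_fun [set: R] f) (mg : measurable_fun [set: R] g).
Hypotheses (f0 : forall x, 0 <= f x) (g0 : forall x, 0 <= g x).

Lemma conv_ge0 y : 0 <= conv f g y.
Proof. by apply: integral_ge0 => u _; exact: mule_ge0. Qed.

Lemma measurable_conv : measurable_fun [set: R] (conv f g).
Proof.
apply: (@measurable_fun_fubini_tonelli_F _ _ (measurableTypeR R)
  (measurableTypeR R) R mu (fun z => f (z.1 - z.2)%R * g z.2)).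
  apply: emeasurable_funM; first exact: measurable_fun_sub2.
  by apply: measurableT_comp => //; exact: measurable_snd.
by move=> z; exact: mule_ge0.
Qed.

End nonneg.

Section assoc.
Variables f g h : R -> \bar R.
Hypotheses (mf : measurable_fun [set: R] f) (mg : measurable_fun [set: R] g).
Hypothesis mh : measurable_fun [set: R] h.
Hypotheses (f0 : forall x, 0 <= f x) (g0 : forall x, 0 <= g x) (h0 : forall x,
  0 <= h x).

(** After Tonelli, [h v] leaves the inner integral, and the translation of [u] by [v] turns [y - u]
    and [u - v] into [y - v - u] and [u]. *)
Lemma convA y : conv f (conv g h) y = conv (conv f g) h y.
Proof.
rewrite {1}/conv.
transitivity (\int[mu]_u \int[mu]_v (f (y - u)%R * (g (u - v)%R * h v))).
  apply: eq_integral => u _; rewrite -ge0_integralZl//.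
  - apply: emeasurable_funM => //; exact: measurable_fun_subl.
  - by move=> v _; exact: mule_ge0.
rewrite (@fubini_tonelli _ _ (measurableTypeR R) (measurableTypeR R) R mu mu
  (fun z => f (y - z.1)%R * (g (z.1 - z.2)%R * h z.2))); last 2 first.
- apply: emeasurable_funM.
    apply: measurableT_comp => //; apply: measurable_funB => //;
      exact: measurable_fst.
  apply: emeasurable_funM; first exact: measurable_fun_sub2.
  by apply: measurableT_comp => //; exact: measurable_snd.
- by move=> z; rewrite !mule_ge0.
apply: eq_integral => v _ /=.
under eq_integral => u _ do rewrite muleA.
rewrite ge0_integralZr//; last 2 first.
- apply: emeasurable_funM; [exact: measurable_fun_subl|
    exact: measurable_fun_subr].
- by move=> u _; exact: mule_ge0.
congr (_ * _); rewrite -(@ge0_integral_shift _ v).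
- by apply: eq_integral => u _; rewrite addrK opprD addrA addrAC.
- apply: emeasurable_funM; [exact: measurable_fun_subl|
    exact: measurable_fun_subr].
- by move=> u; exact: mule_ge0.
Qed.

End assoc.

(** The Laplace transform at the point 1, where the powers give Euler's integral for Gamma. *)
Definition laplace1 f : \bar R := \int[mu]_y ((expR (- y))%:E * f y).

Lemma laplace1_conv f g :
  measurable_fun [set: R] f -> measurable_fun [set: R] g ->
  (forall x, 0 <= f x) -> (forall x, 0 <= g x) ->
  laplace1 (conv f g) = laplace1 f * laplace1 g.
Proof.
move=> mf mg f0 g0.
have mexp : measurable_fun [set: R] (fun y : R => (expR (- y))%:E).
  by apply/measurable_EFinP; apply: measurableT_comp => //;
    exact: measurable_expR.
have e0 y : 0 <= (expR (- y) : R)%:E by rewrite lee_fin expR_ge0.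
rewrite {1}/laplace1.
transitivity (\int[mu]_y \int[mu]_u ((expR (- y))%:E * (f (y - u)%R * g u))).
  apply: eq_integral => y _; rewrite -ge0_integralZl//.
  - apply: emeasurable_funM => //; exact: measurable_fun_subl.
  - by move=> v _; exact: mule_ge0.
rewrite (@fubini_tonelli _ _ (measurableTypeR R) (measurableTypeR R) R mu mu
  (fun z => (expR (- z.1))%:E * (f (z.1 - z.2)%R * g z.2))); last 2 first.
- apply: emeasurable_funM.
    by apply: (measurableT_comp mexp); exact: measurable_fst.
  apply: emeasurable_funM; first exact: measurable_fun_sub2.
  by apply: measurableT_comp => //; exact: measurable_snd.
- by move=> z; rewrite !mule_ge0.
rewrite [in RHS]/laplace1 -ge0_integralZl//; last 3 first.
- exact: emeasurable_funM.
- by move=> u _; exact: mule_ge0.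
- by apply: integral_ge0 => u _; exact: mule_ge0.
apply: eq_integral => u _ /=.
under eq_integral => y _ do rewrite muleA.
rewrite ge0_integralZr//; last 2 first.
- apply: emeasurable_funM => //; exact: measurable_fun_subr.
- by move=> y _; exact: mule_ge0.
rewrite muleA; congr (_ * _); rewrite -(@ge0_integral_shift _ u); last 2 first.
- apply: emeasurable_funM => //; exact: measurable_fun_subr.
- by move=> y; exact: mule_ge0.
rewrite -ge0_integralZr//; last 2 first.
- exact: emeasurable_funM.
- by move=> y _; exact: mule_ge0.
apply: eq_integral => y _; rewrite addrK opprD expRD EFinM.
by rewrite -!muleA; congr (_ * _); rewrite muleC.
Qed.

End Convolution.

(** * Powers cut off at 0 as convolution kernels *)

Section PowerKernel.
Context {R : realType}.
Local Notation mu := (@lebesgue_measure R).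
Implicit Types (p q y : R) (H : R -> R).

Definition cut H : R -> \bar R := (EFin \o H) \_ `]0, +oo[.

Lemma cutE H y : cut H y = if 0 < y then (H y)%:E else 0%E.
Proof.
rewrite /cut patchE; case: ifPn => [|/negP]; rewrite inE/= in_itv/= andbT.
  by move=> ->.
by move=> /negP/negPf ->.
Qed.

Lemma measurable_cut H : {in `]0, +oo[, continuous H} ->
  measurable_fun [set: R] (cut H).
Proof.
move=> cH; apply/(measurable_restrictT _ _).1 => //; apply/measurable_EFinP.
apply: open_continuous_measurable_fun; first exact: interval_open.
by move=> x /set_mem/= xy; exact: cH.
Qed.

Lemma cut_ge0 H : (forall u, 0 < u -> 0 <= H u) -> forall u, (0 <= cut H u)%E.
Proof. by move=> H0 u; rewrite cutE; case: ifPn => // /H0; rewrite lee_fin. Qed.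

(** The kernel k_p without its factor 1 / Gamma p, which is restored in [rl] and [pown]. *)
Definition pw p : R -> \bar R := cut (@powR R ^~ (p - 1)).

Lemma continuous_powRl p : {in `]0, +oo[, continuous (fun u : R => u `^ p)}.
Proof.
move=> x; rewrite in_itv/= andbT => x0.
by apply: differentiable_continuous; apply/derivable1_diffP;
  have [] : is_derive x 1 (@powR R ^~ p) (p * x `^ (p - 1)) by
    exact: is_derive1_powR.
Qed.

Lemma measurable_pw p : measurable_fun [set: R] (pw p).
Proof. by apply: measurable_cut; exact: continuous_powRl. Qed.

Lemma pw_ge0 p u : (0 <= pw p u)%E.
Proof. by apply: cut_ge0 => v _; exact: powR_ge0. Qed.

Lemma pwE p y : 0 < y -> pw p y = (y `^ (p - 1))%:E.
Proof. by move=> y0; rewrite /pw cutE y0. Qed.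

(** The first factor vanishes for [u >= y], the second for [u <= 0]. *)
Lemma conv_pw_cut p H y :
  conv (pw p) (cut H) y =
  (\int[mu]_(u in `]0%R, y[) ((y - u) `^ (p - 1) * H u)%:E)%E.
Proof.
rewrite integral_mkcond; apply: eq_integral => u _.
rewrite /pw !cutE subr_gt0 patchE mem_setE in_itv/=.
by case: (0 < u); case: (u < y); rewrite /= ?mule0 ?mul0e.
Qed.

Lemma laplace1_pw p : laplace1 (pw p) =
  (\int[mu]_(t in `]0%R, +oo[) (t `^ (p - 1) * expR (- t))%:E)%E.
Proof.
rewrite integral_mkcond; apply: eq_integral => u _.
rewrite /pw cutE patchE mem_setE in_itv/= andbT.
by case: (0 < u); rewrite /= ?mule0// muleC EFinM.
Qed.

(** For p < 1 the integrand blows up at 0. It is therefore read as the derivative of u^p / p in a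
    substitution on the open interval, with the constant 1 integrated over the image ]0, y^p /
    p[. *)
Lemma integral_powR_itvoo p y : 0 < p -> 0 < y ->
  (\int[mu]_(u in `]0%R, y[) (u `^ (p - 1))%:E = (y `^ p / p)%:E)%E.
Proof.
move=> p0 y0.
pose F (u : R) := p^-1 * u `^ p; pose w (u : R) := u `^ (p - 1).
have homoF : {in `[0%R, y] &, {homo F : x z / x < z}}.
  move=> x z; rewrite !in_itv/= => /andP[x0 _] /andP[z0 _] xz.
  by rewrite /F ltr_pM2l ?invr_gt0//; apply: gt0_ltr_powR; rewrite ?nnegrE.
have FyE : F y = y `^ p / p by rewrite mulrC.
have F0 : F 0 = 0 by rewrite /F powR0 ?mulr0// gt_eqF.
have imF : F @` `]0%R, y[ = `]0%R, (y `^ p / p)%R[%classic.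
  apply/seteqP; split; first by rewrite -FyE -{2}F0; exact: increasing_image_oo.
  move=> s /=; rewrite in_itv/= => /andP[s0 sy].
  have ps0 : 0 < p * s by rewrite mulr_gt0.
  exists ((p * s) `^ p^-1) => /=; last first.
    by rewrite /F -powRrM mulVf ?gt_eqF// powRr1 ?(ltW ps0)// mulrA mulVf
      ?gt_eqF// mul1r.
  rewrite in_itv/= powR_gt0//=.
  have -> : y = (y `^ p) `^ p^-1 by rewrite -powRrM mulfV ?gt_eqF// powRr1// ltW.
  apply: gt0_ltr_powR; rewrite ?invr_gt0 ?nnegrE ?powR_ge0 ?(ltW ps0)//.
  by rewrite mulrC -ltr_pdivlMr.
have dF t : t \in `]0, y[ -> is_derive t 1 F (w t).
  rewrite in_itv/= => /andP[t0 ty].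
  have H : is_derive t 1 (@powR R ^~ p) (p * t `^ (p - 1)) by
    exact: is_derive1_powR.
  have -> : w t = p^-1 *: (p * t `^ (p - 1)).
    by rewrite /w /GRing.scale/= mulrA mulVf ?mul1r// gt_eqF.
  exact: is_deriveZ.
have cw t : t \in `]0, y[ -> {for t, continuous w}.
  rewrite in_itv/= => /andP[t0 ty].
  by apply: continuous_powRl; rewrite in_itv/= t0.
have := ge0_substitution_increasing_oo (G := cst 1) y0 dF cw
  (fun _ _ => @cst_continuous _ _ _ _) (fun _ _ => ler01).
rewrite imF (_ : (fun _ => _) = cst 1%E)// integral_cst//= mul1e
  lebesgue_measure_itv/= lte_fin divr_gt0 ?powR_gt0//.
rewrite -EFinB subr0 => ->.
- by apply: eq_integral => t _; rewrite mul1r.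
- by move=> x z xy zy; apply: homoF; exact: subset_itv_oo_cc.
- by move=> t _; exact: powR_ge0.
Qed.

End PowerKernel.

(** * Finiteness and positivity of Gamma; the Beta constant *)

Section GammaBeta.
Context {R : realType}.
Local Notation mu := (@lebesgue_measure R).
Implicit Types (p q y : R) (H : R -> R).

Lemma powR_le_expR_half p : 0 < p -> exists2 C : R, 0 <= C &
  forall t, 1 <= t -> t `^ (p - 1) <= C * expR (t / 2).
Proof.
move=> p0; pose N := Num.bound p.
have pN : p < N%:R by rewrite archi_boundP// ltW.
have N0 : 0 < N%:R :> R by exact: lt_trans pN.
(* From x <= exp x at x = t / (2N): t^N <= (2N)^N exp(t / (2N))^N = (2N)^N exp(t / 2), while t^(p-1)
   <= t^N for t >= 1. *)
exists ((N%:R * 2) ^+ N) => [|t t1]; first by rewrite exprn_ge0// mulr_ge0// ltW.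
have t0 : 0 < t by rewrite (lt_le_trans _ t1).
apply: (@le_trans _ _ (t `^ N%:R)); first by apply: ler_powR => //; lra.
rewrite powR_mulrn ?(ltW t0)//.
have -> : t / 2 = N%:R * (t / (N%:R * 2)) by field; rewrite gt_eqF.
rewrite expRM_natl -exprMn lerXn2r ?nnegrE ?(ltW t0) ?mulr_ge0 ?expR_ge0 ?(ltW
  N0)//.
rewrite mulrC -ler_pdivrMr ?mulr_gt0//.
by apply: le_trans (expR_ge1Dx _); rewrite lerDr.
Qed.

Lemma measurable_expRN_pw p :
  measurable_fun [set: R] (fun u => (expR (- u))%:E * pw p u)%E.
Proof.
apply: emeasurable_funM; last exact: measurable_pw.
by apply/measurable_EFinP; apply: measurableT_comp => //; exact: measurable_expR.
Qed.

Lemma laplace1_pw_lty p : 0 < p -> (laplace1 (pw p) < +oo)%E.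
Proof.
move=> p0; have [C C0 HC] := powR_le_expR_half p0.
(* Below 1 the exponential is at most 1 and the power alone is integrable. From 1 on the integrand
   is at most C exp(-u / 2), that is 2 C times the exponential density of rate 1/2. *)
pose f1 := pw p \_ `]0, 1[; pose f2 (u : R) : \bar R := (C * 2 *
  exponential_pdf 2^-1 u)%:E.
have h0 : 0 < 2^-1 :> R by rewrite invr_gt0.
have mf1 : measurable_fun [set: R] f1.
  by apply/(measurable_restrictT _ _).1 => //; apply: measurable_funTS;
    exact: measurable_pw.
have mf2 : measurable_fun [set: R] f2.
  apply/measurable_EFinP; apply: measurable_funM => //;
    exact: measurable_exponential_pdf.
have f10 u : (0 <= f1 u)%E by rewrite /f1 patchE; case: ifP => // _;
  exact: pw_ge0.
have f20 u : (0 <= f2 u)%E.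
  by rewrite lee_fin mulr_ge0 ?mulr_ge0// exponential_pdf_ge0// ltW.
apply: (@le_lt_trans _ _ (\int[mu]_u (f1 u + f2 u)))%E.
  apply: ge0_le_integral => //.
  - by move=> u _; rewrite mule_ge0 ?lee_fin ?expR_ge0 ?pw_ge0.
  - exact: measurable_expRN_pw.
  - exact: emeasurable_funD.
  - move=> u _; have [u0|u0] := leP u 0.
      by rewrite /pw cutE ltNge u0/= mule0 adde_ge0.
    have [u1|u1] := ltP u 1.
      rewrite /f1 patchE mem_setE in_itv/= u0 u1/=.
      rewrite -[leLHS]adde0 leeD// pwE// -EFinM lee_fin ler_piMl ?powR_ge0//.
      by rewrite -expR0 ler_expR oppr_le0 ltW.
    rewrite -[leLHS]add0e leeD// pwE// -EFinM lee_fin /exponential_pdf patchE.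
    rewrite mem_setE in_itv/= (ltW u0)/=.
    apply: (@le_trans _ _ (expR (- u) * (C * expR (u / 2)))).
      by rewrite ler_pM2l ?expR_gt0//; exact: HC.
    have -> : - 2^-1 * u = - u + u / 2 by field.
    by rewrite expRD le_eqVlt; apply/orP; left; apply/eqP; field.
rewrite ge0_integralD//; apply: lte_add_pinfty.
  rewrite -integral_mkcond.
  rewrite (_ : (\int[mu]_(u in _) _)%E = (1 `^ p / p)%:E) ?ltry//.
  rewrite -(integral_powR_itvoo p0 ltr01); apply: eq_integral.
  by move=> u /set_mem/=; rewrite in_itv/= => /andP[u0 _]; rewrite pwE.
rewrite /f2; under eq_integral do rewrite EFinM.
rewrite ge0_integralZl//.
- by rewrite integral_exponential_pdf// mule1 ltry.
- apply/measurable_EFinP; exact: measurable_exponential_pdf.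
- by move=> u _; rewrite lee_fin exponential_pdf_ge0// ltW.
- by rewrite lee_fin mulr_ge0.
Qed.

Lemma laplace1_pw_gt0 p : 0 < p -> (0 < laplace1 (pw p))%E.
Proof.
move=> p0.
(* On ]1, 2[ the exponential is at least exp(-2), and u^(p-1) >= u^(-1) >= 1/2 because p - 1 > -1
   and u > 1. *)
pose c : R := expR (- 2) / 2.
have c0 : 0 < c by rewrite divr_gt0// expR_gt0.
apply: (@lt_le_trans _ _ (\int[mu]_(u in `]1%R, 2%R[) c%:E))%E.
  rewrite integral_cst//= lebesgue_measure_itv/= lte_fin ltr1n -EFinB.
  by rewrite -EFinM lte_fin mulr_gt0//; lra.
rewrite integral_mkcond; apply: ge0_le_integral => //.
- by move=> u _; rewrite patchE; case: ifP => // _; rewrite lee_fin ltW.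
- by apply/(measurable_restrictT _ _).1.
- exact: measurable_expRN_pw.
move=> u _; rewrite patchE mem_setE in_itv/=; case: ifPn => [/andP[u1 u2]|_];
  last first.
  by rewrite mule_ge0 ?pw_ge0// lee_fin expR_ge0.
have u0 : 0 < u by rewrite (lt_trans _ u1).
rewrite pwE// -EFinM lee_fin ler_pM ?expR_ge0//.
  by rewrite ler_expR lerN2 ltW.
apply: (@le_trans _ _ (u `^ (- 1))).
  by rewrite powR_inv1 ?(ltW u0)// lef_pV2 ?posrE// ltW.
by apply: ler_powR; [rewrite ltW|lra].
Qed.

(** [Gamma] is a real-valued integral, obtained by [fine] from the extended one; finiteness makes
    the two agree. *)
Lemma laplace1_pwE p : 0 < p -> laplace1 (pw p) = (Gamma p)%:E.
Proof.
move=> p0; rewrite /Gamma /Rintegral -laplace1_pw fineK// ge0_fin_numE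
  ?laplace1_pw_lty//.
exact/ltW/laplace1_pw_gt0.
Qed.

Lemma Gamma_gt0 p : 0 < p -> 0 < Gamma p.
Proof. by move=> p0; rewrite -lte_fin -laplace1_pwE//;
  exact: laplace1_pw_gt0. Qed.

(** For p = 1 the integrand is the density of the exponential distribution of rate 1, of total mass
    1. *)
Lemma Gamma1 : Gamma (1 : R) = 1.
Proof.
apply/EFin_inj; rewrite -laplace1_pwE//.
rewrite -(@integral_exponential_pdf R 1 ltr01) laplace1_pw.
rewrite integral_itv_obnd_cbnd; last first.
  apply/measurable_EFinP; apply: measurable_funTS; apply: measurable_funM;
    first exact: measurable_powR.
  by apply: measurableT_comp => //; exact: measurable_expR.
rewrite integral_mkcond; apply: eq_integral => u _;
  rewrite /exponential_pdf !patchE.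
by case: ifP => // _; rewrite subrr powRr0 mulN1r.
Qed.

(** Homogeneity through u = y s: the powers contribute y^(p-1) y^(q-1) and the differential one more
    factor y. The constant is left as an extended number because its finiteness is not yet known. *)
Lemma conv_pw p q y : 0 < p -> 0 < q ->
  conv (pw p) (pw q) y = (conv (pw p) (pw q) 1 * pw (p + q) y)%E.
Proof.
move=> p0 q0; rewrite [pw (p + q) _]/pw cutE; case: ifPn => [y0|]; last first.
  rewrite -leNgt => y0; rewrite mule0 /conv integral0_eq// => u _.
  rewrite /pw !cutE subr_gt0; case: ifPn => [uy|]; last by rewrite mul0e.
  by rewrite ltNge (le_trans (ltW uy) y0)/= mule0.
rewrite !conv_pw_cut.
pose F (s : R) := y * s.
have imF : F @` `]0%R, 1%R[ = `]0%R, y[%classic.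
  apply/seteqP; split => [_ [s /=] + <-|u /=]; rewrite !in_itv/= => /andP[s0 s1].
    by rewrite /F mulr_gt0//= gtr_pMr.
  exists (u / y); last by rewrite /F mulrCA divff ?mulr1// gt_eqF.
  by rewrite /= in_itv/= divr_gt0//= ltr_pdivrMr// mul1r.
have dF (t : R) : t \in `]0, 1[ -> is_derive t 1 F (cst y t).
  by move=> _; rewrite /= -[X in is_derive _ _ _ X]mulr1;
    exact: (@is_deriveZ _ _ _ id).
pose G u := (y - u) `^ (p - 1) * u `^ (q - 1).
have FG (t : R) : t \in `]0, 1[ -> {for F t, continuous G}.
  move=> /[dup] t01; rewrite in_itv/= => /andP[t0 t1].
  have Ft0 : 0 < F t by rewrite mulr_gt0.
  have Fty : F t < y by rewrite /F gtr_pMr.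
  apply: cvgM.
    apply: (@continuous_comp _ _ _ (fun u => y - u) (fun u => u `^ (p - 1))).
      by apply: cvgB; [exact: cvg_cst|exact: cvg_id].
    by apply: continuous_powRl; rewrite in_itv/= subr_gt0 Fty.
  by apply: continuous_powRl; rewrite in_itv/= Ft0.
have := ge0_substitution_increasing_oo ltr01 dF
  (fun _ _ => @cst_continuous _ _ _ _) FG.
rewrite imF => ->.
- rewrite -ge0_integralZr//.
  + apply: eq_integral => s /set_mem/=; rewrite in_itv/= => /andP[s0 s1].
    rewrite /= -EFinM; congr EFin; rewrite /G /F.
    have -> : y - y * s = y * (1 - s) by ring.
    rewrite !powRM ?(ltW y0) ?(ltW s0) ?subr_ge0 ?(ltW s1)//.
    have -> : y `^ (p + q - 1) = y `^ (p - 1) * y `^ (q - 1) * y `^ 1.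
      have yn0 (r : R) : (r == 0) ==> (y != 0) by rewrite (gt_eqF y0) implybT.
      by rewrite -(powRD (yn0 _)) -(powRD (yn0 _)); congr (y `^ _); ring.
    by rewrite (powRr1 (ltW y0)); ring.
  + apply/measurable_EFinP/measurable_funTS; apply: measurable_funM;
      last exact: measurable_powR.
    apply: (@measurableT_comp _ _ _ _ _ _ (fun u => u `^ (p - 1)) _ (fun s : R
      => 1 - s)); first exact: measurable_powR.
    exact: measurable_funB.
  + by move=> s _; rewrite lee_fin mulr_ge0// powR_ge0.
  + by rewrite lee_fin powR_ge0.
- by move=> t _; rewrite mulr_ge0// powR_ge0.
- by move=> s t _ _ st; rewrite /F ltr_pM2l.
- by move=> t _; exact: ltW.
Qed.

Definition Beta p q : R := Gamma p * Gamma q / Gamma (p + q).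

Lemma conv_pwE p q y : 0 < p -> 0 < q ->
  conv (pw p) (pw q) y = ((Beta p q)%:E * pw (p + q) y)%E.
Proof.
move=> p0 q0; rewrite conv_pw//; congr (_ * _)%E.
(* Taking [laplace1] of the homogeneity relation gives B Gamma(p + q) = Gamma p Gamma q. The right
   side is finite and Gamma(p + q) > 0, so B = +oo is impossible. *)
set B := conv _ _ 1.
have B0 : (0 <= B)%E by apply: conv_ge0 => u; exact: pw_ge0.
have pq0 : 0 < p + q by rewrite addr_gt0.
have := laplace1_conv (measurable_pw p) (measurable_pw q) (@pw_ge0 R p)
  (@pw_ge0 R q).
rewrite !laplace1_pwE//.
rewrite (_ : laplace1 _ = (B * (Gamma (p + q))%:E)%E); last first.
  rewrite -laplace1_pwE// /laplace1 -ge0_integralZl//.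
  - by apply: eq_integral => u _; rewrite conv_pw// muleCA.
  - exact: measurable_expRN_pw.
  - by move=> u _; rewrite mule_ge0 ?pw_ge0 ?lee_fin ?expR_ge0.
have Gpq := Gamma_gt0 pq0.
move: B0; case: B => [b _||//].
  rewrite -!EFinM => -[E]; congr EFin; rewrite /Beta -E mulfK// gt_eqF//.
by rewrite gt0_mulye ?lte_fin// -EFinM.
Qed.

End GammaBeta.

(** * Transport of integrals of signed functions *)

Section Transport.
Context {R : realType}.
Local Notation mu := (@lebesgue_measure R).
Implicit Types (I J : set R) (T w G H : R -> R).

(** The substitution u = T t as a property of its data, with [w] in the place of |T'|, so that
    increasing and decreasing substitutions are treated alike afterwards. *)
Definition transports I J T w : Prop :=
  forall G, (forall u, J u -> {for u, continuous G} /\ 0 <= G u) ->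
  (\int[mu]_(u in J) (G u)%:E = \int[mu]_(t in I) (G (T t) * w t)%:E)%E.

Lemma continuous_norm_at H u : {for u, continuous H} -> {for u, continuous (fun
  v => `|H v|)}.
Proof. by move=> cH; apply: (@continuous_comp _ _ _ H Num.norm) => //;
  exact: norm_continuous. Qed.

Lemma open_continuous_measurable_EFin I H : open I -> (forall t, I t ->
  {for t, continuous H}) ->
  measurable_fun I (EFin \o H).
Proof.
move=> oI cH; apply/measurable_EFinP; apply: open_continuous_measurable_fun => //.
by move=> t /set_mem; exact: cH.
Qed.

Lemma transports_integrable I J T w G : open I -> open J ->
  transports I J T w -> (forall t, I t -> J (T t)) -> (forall t, I t -> 0 <= w
    t) ->
  (forall t, I t -> {for t, continuous T}) -> (forall t, I t ->
    {for t, continuous w}) ->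
  (forall u, J u -> {for u, continuous G}) ->
  mu.-integrable J (EFin \o G) ->
  mu.-integrable I (EFin \o (fun t => G (T t) * w t)) /\
  \int[mu]_(t in I) (G (T t) * w t) = \int[mu]_(u in J) G u.
Proof.
move=> oI oJ tr IJ w0 cT cw.
have mI : measurable I by exact: open_measurable.
have mJ : measurable J by exact: open_measurable.
(* Integrability concerns |K| only, to which the rule for nonnegative integrands applies. *)
have key (K : R -> R) : (forall u, J u -> {for u, continuous K}) ->
    mu.-integrable J (EFin \o K) -> mu.-integrable I (EFin \o (fun t =>
      K (T t) * w t)).
  move=> cK iK; apply/integrableP; split.
    apply: open_continuous_measurable_EFin => // t It.
    by apply: cvgM; [apply: continuous_comp; [exact: cT|apply: cK;
      exact: IJ]|exact: cw].
  have /integrableP[_] := iK; rewrite /= (tr (fun u => `|K u|)) => [|u Ju];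
    last first.
    by split => //; apply: continuous_norm_at; exact: cK.
  congr (_ < _)%E; apply: eq_integral => t /set_mem It.
  by rewrite normrM (ger0_norm (w0 _ It)).
have pos (K : R -> R) : (forall u, J u -> {for u, continuous K}) -> (forall u,
  J u -> 0 <= K u) ->
    \int[mu]_(t in I) (K (T t) * w t) = \int[mu]_(u in J) K u.
  by move=> cK K0; rewrite /Rintegral tr// => u Ju; split; [exact: cK|exact: K0].
move=> cG iG; split; first exact: key.
(* [G = G1 - G2] with [G1] and [G2] continuous and nonnegative *)
pose G1 u := `|G u|; pose G2 u := `|G u| - G u.
have cG1 u : J u -> {for u, continuous G1} by move=> Ju;
  apply: continuous_norm_at; exact: cG.
have cG2 u : J u -> {for u, continuous G2} by move=> Ju; apply: cvgB;
  [exact: cG1|exact: cG].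
have iG1 : mu.-integrable J (EFin \o G1) by exact: integrable_abse iG.
have iG2 : mu.-integrable J (EFin \o G2).
  by rewrite (_ : _ \o _ = (EFin \o G1) \- (EFin \o G))%E//; exact: integrableB.
transitivity (\int[mu]_(t in I) (G1 (T t) * w t - G2 (T t) * w t)).
  by apply: eq_Rintegral => t _; rewrite -mulrBl /G1 /G2 opprB addrC subrK.
rewrite RintegralB//; try exact: key.
rewrite (pos _ cG1 (fun _ _ => normr_ge0 _)) (pos _ cG2); last first.
  by move=> u _; rewrite subr_ge0 ler_norm.
rewrite -RintegralB//; apply: eq_Rintegral => u _.
by rewrite /G1 /G2 opprB addrC subrK.
Qed.

End Transport.

(** * Riemann-Liouville integrals on ]0, +oo[ *)

Section RiemannLiouville.
Context {R : realType}.
Local Notation mu := (@lebesgue_measure R).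
Implicit Types (p q y : R) (H K : R -> R).

Definition kern p H y u : R := (y - u) `^ (p - 1) * H u.

Definition rl p H y : R := (Gamma p)^-1 * \int[mu]_(u in `]0, y[) kern p H y u.

Definition rl_defined p H y : Prop :=
  mu.-integrable `]0, y[ (EFin \o kern p H y).

(* A class stable under [rl p], whose members may fail to be continuous at 0. *)
Definition tame H : Prop :=
  (forall u : R, 0 < u -> {for u, continuous H}) /\
  (forall y, exists M : R, forall u : R, 0 < u -> u < y -> `|H u| <= M).

Lemma tame_cst (c : R) : tame (fun=> c).
Proof.
split; first by move=> u _; exact: cst_continuous.
by move=> y; exists `|c|.
Qed.

Lemma tameD H K : tame H -> tame K -> tame (fun u => H u + K u).
Proof.
move=> [cH bH] [cK bK]; split=> [u u0|y]; first by apply: cvgD;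
  [exact: cH|exact: cK].
have [M HM] := bH y; have [N HN] := bK y; exists (M + N) => u u0 uy.
by rewrite (le_trans (ler_normD _ _))// lerD ?HM ?HN.
Qed.

Lemma tameN H : tame H -> tame (fun u => - H u).
Proof.
move=> [cH bH]; split=> [u u0|y]; first by apply: cvgN; exact: cH.
by have [M HM] := bH y; exists M => u u0 uy; rewrite normrN HM.
Qed.

Lemma tame_norm H : tame H -> tame (fun u => `|H u|).
Proof.
move=> [cH bH]; split=> [u u0|y]; first by apply: continuous_norm_at; exact: cH.
by have [M HM] := bH y; exists M => u u0 uy; rewrite normr_id HM.
Qed.

Lemma continuous_powR_gt0 p u : 0 < u -> {for u, continuous (@powR R ^~ p)}.
Proof. by move=> u0; apply: continuous_powRl; rewrite in_itv/= u0. Qed.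

Lemma continuous_kern p H y u : (forall v : R, 0 < v -> {for v, continuous H}) ->
  `]0, y[%classic u -> {for u, continuous (kern p H y)}.
Proof.
move=> cH; rewrite /= in_itv/= => /andP[u0 uy]; apply: cvgM; last exact: cH.
apply: (@continuous_comp _ _ _ (fun u => y - u) (fun u => u `^ (p - 1))).
  by apply: cvgB; [exact: cvg_cst|exact: cvg_id].
by apply: continuous_powR_gt0; rewrite subr_gt0.
Qed.

Lemma measurable_kern p H y : (forall u : R, 0 < u -> {for u, continuous H}) ->
  measurable_fun `]0, y[ (EFin \o kern p H y).
Proof.
move=> cH; apply: open_continuous_measurable_EFin; first exact: interval_open.
by move=> u; exact: continuous_kern.
Qed.

Lemma integral_kern_powR p q y : 0 < p -> 0 < q -> 0 < y ->
  (\int[mu]_(u in `]0%R, y[) (kern p (@powR R ^~ (q - 1)) y u)%:E =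
   (Beta p q * y `^ (p + q - 1))%:E)%E.
Proof. by move=> p0 q0 y0; rewrite -conv_pw_cut conv_pwE// pwE// -EFinM. Qed.

Lemma rl_defined_powR p q y : 0 < p -> 0 < q -> 0 < y ->
  rl_defined p (@powR R ^~ (q - 1)) y.
Proof.
move=> p0 q0 y0; apply/integrableP; split.
  by apply: measurable_kern => u; exact: continuous_powR_gt0.
rewrite (_ : (\int[mu]_(u in _) _)%E = (Beta p q * y `^ (p + q - 1))%:E) ?ltry//.
rewrite -integral_kern_powR//; apply: eq_integral.
by move=> u _ /=; rewrite ger0_norm// mulr_ge0// powR_ge0.
Qed.

(** Makes the constant 1 the case q = 1 of the powers, whose integrals are known. *)
Lemma kern_cst1 p y u : kern p (fun=> 1) y u = kern p (@powR R ^~ (1 - 1)) y u.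
Proof. by rewrite /kern subrr powRr0. Qed.

(** Domination by M (y - u)^(p-1), where M bounds |H| on ]0, y[. *)
Lemma rl_defined_tame p H y : 0 < p -> 0 < y -> tame H -> rl_defined p H y.
Proof.
move=> p0 y0 [cH bH]; have [M HM] := bH y.
have : mu.-integrable `]0, y[ (fun u => M%:E * (kern p (@powR R ^~ (1 - 1)) y
  u)%:E)%E.
  by apply: integrableZl => //; exact: rl_defined_powR.
apply: le_integrable => //; first exact: measurable_kern.
move=> u /=; rewrite in_itv/= => /andP[u0 uy].
rewrite lee_fin -kern_cst1 /kern mulr1 [in leRHS]mulrC 2!normrM.
by rewrite ler_wpM2l// (le_trans (HM _ u0 uy))// ler_norm.
Qed.

Lemma conv_pw_cut_rl p H y : 0 < p -> rl_defined p H y ->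
  conv (pw p) (cut H) y = (Gamma p * rl p H y)%:E.
Proof.
move=> p0 dH; rewrite conv_pw_cut /rl mulrA divff ?mul1r ?gt_eqF ?Gamma_gt0//.
by rewrite /Rintegral fineK// integrable_fin_num.
Qed.

Lemma eq_rl p H K y : (forall u : R, 0 < u -> u < y -> H u = K u) -> rl p H y =
  rl p K y.
Proof.
move=> HK; congr (_ * _); apply: eq_Rintegral => u /set_mem/=.
by rewrite in_itv/= => /andP[u0 uy]; rewrite /kern HK.
Qed.

Lemma rlB p H K y : rl_defined p H y -> rl_defined p K y ->
  rl p (fun u => H u - K u) y = rl p H y - rl p K y.
Proof.
move=> dH dK; rewrite /rl -mulrBr -RintegralB//; congr (_ * _).
by apply: eq_Rintegral => u _; rewrite /kern mulrBr.
Qed.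

Lemma rlZ p H y (c : R) : rl_defined p H y ->
  rl p (fun u => c * H u) y = c * rl p H y.
Proof.
move=> dH; rewrite /rl mulrCA; congr (_ * _); rewrite -RintegralZl//.
by apply: eq_Rintegral => u _; rewrite /kern mulrCA.
Qed.

Lemma rl_definedZ p H y (c : R) : rl_defined p H y -> rl_defined p (fun u =>
  c * H u) y.
Proof.
move=> dH; rewrite /rl_defined (_ : _ \o _ = (fun u =>
  c%:E * (kern p H y u)%:E)%E).
  exact: integrableZl.
by apply/funext => u; rewrite /= /kern -EFinM mulrCA.
Qed.

Lemma rl_definedD p H K y : rl_defined p H y -> rl_defined p K y ->
  rl_defined p (fun u => H u + K u) y.
Proof.
move=> dH dK; rewrite /rl_defined.
rewrite (_ : _ \o _ = (EFin \o kern p H y) \+ (EFin \o kern p K y))%E.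
  exact: integrableD.
by apply/funext => u; rewrite /= /kern -EFinD mulrDr.
Qed.

Lemma rlD p H K y : rl_defined p H y -> rl_defined p K y ->
  rl p (fun u => H u + K u) y = rl p H y + rl p K y.
Proof.
move=> dH dK; rewrite /rl -mulrDr -RintegralD//; congr (_ * _).
by apply: eq_Rintegral => u _; rewrite /kern mulrDr.
Qed.

(** The normalised kernel k_q. *)
Definition pown q u : R := (Gamma q)^-1 * u `^ (q - 1).

Lemma rl_defined_pown p q y : 0 < p -> 0 < q -> 0 < y -> rl_defined p (pown q) y.
Proof. by move=> p0 q0 y0; apply: rl_definedZ; exact: rl_defined_powR. Qed.

Lemma rl_pown p q y : 0 < p -> 0 < q -> 0 < y -> rl p (pown q) y = pown (p + q) y.
Proof.
move=> p0 q0 y0; rewrite rlZ; last exact: rl_defined_powR.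
rewrite /rl /Rintegral integral_kern_powR//= /pown /Beta.
have := Gamma_gt0 p0; have := Gamma_gt0 q0; have := Gamma_gt0 (addr_gt0 p0 q0).
move: (Gamma p) (Gamma q) (Gamma (p + q)) => Gp Gq Gpq Gpq0 Gq0 Gp0.
by field; rewrite !gt_eqF.
Qed.

Lemma pown1 u : pown 1 u = 1.
Proof. by rewrite /pown Gamma1 subrr powRr0 invr1 mulr1. Qed.

Lemma continuous_pown q u : 0 < u -> {for u, continuous (pown q)}.
Proof. by move=> u0; apply: cvgM; [exact: cvg_cst|exact: continuous_powR_gt0].
  Qed.

(** With u = y s both the domain of integration and the singular factor become independent of [y],
    which is what continuity in [y] requires. *)
Lemma rl_scale p H y : 0 < p -> 0 < y -> tame H ->
  rl p H y = y `^ p * ((Gamma p)^-1 * \int[mu]_(s in `]0, 1[) ((1 - s) `^ (p -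
    1) * H (y * s))).
Proof.
move=> p0 y0 tH; have [cH _] := tH; rewrite [RHS]mulrCA; congr (_ * _).
have dF (t : R) : t \in `]0, 1[ -> is_derive t 1 ( *%R y) (cst y t).
  by move=> _; rewrite /= -[X in is_derive _ _ _ X]mulr1;
    exact: (@is_deriveZ _ _ _ id).
have imF : *%R y @` `]0, 1[ = `]0, y[%classic.
  apply/seteqP; split => [_ [s /=] + <-|u /=]; rewrite !in_itv/= => /andP[s0 s1].
    by rewrite mulr_gt0//= gtr_pMr.
  exists (u / y); last by rewrite mulrCA divff ?mulr1// gt_eqF.
  by rewrite /= in_itv/= divr_gt0//= ltr_pdivrMr// mul1r.
have tr : transports `]0, 1[ `]0, y[ ( *%R y) (cst y).
  move=> G cG; rewrite -imF.
  have yt t : t \in `]0, 1[ -> `]0, y[%classic (y * t).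
    by move=> t01; rewrite -imF; exists t.
  apply: (ge0_substitution_increasing_oo ltr01 dF) => //.
  - by move=> t _; exact: cst_continuous.
  - by move=> t /yt/cG[].
  - by move=> t /yt/cG[].
  - by move=> s t _ _ st; rewrite ltr_pM2l.
  - by move=> t _; exact: ltW.
have := @transports_integrable R `]0, 1[%classic `]0, y[%classic _ _ (kern p H y)
  (@interval_open _ _ _ _ _) (@interval_open _ _ _ _ _) tr.
case=> //.
- by move=> t t01; rewrite -imF; exists t.
- by move=> t _; exact: ltW.
- by move=> t _; apply: cvgM; [exact: cvg_cst|exact: cvg_id].
- by move=> t _; exact: cst_continuous.
- by move=> u; exact: continuous_kern.
- exact: rl_defined_tame.
move=> _ <-.
have tHs : tame (fun s => H (y * s)).
  split=> [u u0|z].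
    apply: (@continuous_comp _ _ _ ( *%R y) H); last by apply: cH;
      rewrite mulr_gt0.
    by apply: cvgM; [exact: cvg_cst|exact: cvg_id].
  have [_ /(_ (y * z))[M HM]] := tH; exists M => u u0 uz.
  by apply: HM; rewrite ?mulr_gt0// ltr_pM2l.
have d1 : rl_defined p (fun s => H (y * s)) 1 by exact: rl_defined_tame.
rewrite -RintegralZl//; apply: eq_Rintegral => s /set_mem/=.
rewrite in_itv/= => /andP[s0 s1]; rewrite /kern /=.
have -> : y - y * s = y * (1 - s) by ring.
rewrite powRM ?(ltW y0) ?subr_ge0 ?(ltW s1)//.
by rewrite -(mulr_powRB1 (ltW y0) p0); ring.
Qed.

Lemma le_rl p H K y : 0 < p -> rl_defined p H y -> rl_defined p K y ->
  (forall u : R, 0 < u -> u < y -> H u <= K u) -> rl p H y <= rl p K y.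
Proof.
move=> p0 dH dK HK; rewrite ler_wpM2l ?invr_ge0 ?(ltW (Gamma_gt0 p0))//.
apply: le_Rintegral => // u /=; rewrite in_itv/= => /andP[u0 uy].
by rewrite ler_wpM2l ?powR_ge0 ?HK.
Qed.

Lemma ler_norm_rl p H y : 0 < p -> rl_defined p H y ->
  `|rl p H y| <= rl p (fun u => `|H u|) y.
Proof.
move=> p0 dH; rewrite normrM ger0_norm ?invr_ge0 ?(ltW (Gamma_gt0 p0))//.
rewrite ler_wpM2l ?invr_ge0 ?(ltW (Gamma_gt0 p0))//.
apply: (le_trans (le_normr_Rintegral _ dH)) => //.
rewrite le_eqVlt; apply/orP; left; apply/eqP; apply: eq_Rintegral => u _.
by rewrite normrM ger0_norm ?powR_ge0.
Qed.

Lemma rl_cst p y (c : R) : 0 < p -> 0 < y -> rl p (fun=> c) y = c * pown (p +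
  1) y.
Proof.
move=> p0 y0; rewrite -(rl_pown p0 ltr01 y0) -rlZ; last exact: rl_defined_pown.
by apply: eq_rl => u _ _; rewrite pown1 mulr1.
Qed.

Lemma continuous_rl p H y : 0 < p -> 0 < y -> tame H -> {for y, continuous (rl
  p H)}.
Proof.
move=> p0 y0 tH; have [cH bH] := tH.
pose f (x s : R) := (1 - s) `^ (p - 1) * H (x * s).
pose F (x : R) := \int[mu]_(s in `]0, 1[) f x s.
have cF : {for y, continuous F}.
  (* For x in ]y/2, 2y[ and s in ]0, 1[ the product x s stays in ]0, 2y[, so this [M] gives a
     majorant (1 - s)^(p-1) M valid for all these x. *)
  have [M HM] := bH (y * 2).
  pose g (s : R) := M * kern p (fun=> 1) 1 s.
  apply: (@continuity_under_integral R _ _ mu f `]0, 1[%classic (measurable_itv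
    _) (y / 2) (y * 2) _ _ g).
  - move=> x /=; rewrite in_itv/= => /andP[xy1 xy2].
    have x0 : 0 < x by rewrite (lt_trans _ xy1)// divr_gt0.
    apply: (@rl_defined_tame p (fun s => H (x * s)) 1) => //; split=> [u u0|z].
      apply: (@continuous_comp _ _ _ ( *%R x) H); last by apply: cH;
        rewrite mulr_gt0.
      by apply: cvgM; [exact: cvg_cst|exact: cvg_id].
    have [N HN] := bH (x * z); exists N => u u0 uz.
    by apply: HN; rewrite ?mulr_gt0// ltr_pM2l.
  - apply/aeW => s /=; rewrite in_itv/= => /andP[s0 s1] x.
    rewrite inE/= in_itv/= => /andP[xy1 xy2].
    have x0 : 0 < x by rewrite (lt_trans _ xy1)// divr_gt0.
    have c1 : {for x, continuous (fun z : R => z * s)}.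
      by apply: cvgM; [exact: cvg_id|exact: cvg_cst].
    have c2 : {for x, continuous (fun z : R => H (z * s))}.
      by apply: (continuous_comp c1); apply: cH; rewrite mulr_gt0.
    by apply: cvgM; [exact: cvg_cst|exact: c2].
  - rewrite (_ : _ \o _ = (fun s => M%:E * (kern p (fun=> 1) 1 s)%:E)%E)//.
    by apply: integrableZl => //; apply: rl_defined_tame => //; exact: tame_cst.
  - move=> x /=; rewrite in_itv/= => /andP[xy1 xy2].
    have x0 : 0 < x by rewrite (lt_trans _ xy1)// divr_gt0.
    apply/aeW => s /=; rewrite in_itv/= => /andP[s0 s1].
    rewrite /f /g /kern mulr1 normrM (ger0_norm (powR_ge0 _ _)) mulrC.
    rewrite ler_wpM2r ?powR_ge0// HM ?mulr_gt0//.
    by rewrite (lt_trans _ xy2)// gtr_pMr.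
  by rewrite inE/= in_itv/= ltr_pMr// ltr1n ltr_pdivrMr// ltr_pMr// ltr1n.
have cG : {for y, continuous (fun x => x `^ p * ((Gamma p)^-1 * F x))}.
  apply: cvgM; first exact: continuous_powR_gt0.
  by apply: cvgM; [exact: cvg_cst|exact: cF].
rewrite /prop_for /continuous_at rl_scale//; apply: cvg_trans cG.
apply: near_eq_cvg; near=> x; rewrite rl_scale//.
by near: x; exact: lt_nbhsr.
Unshelve. all: by end_near. Qed.

Lemma tame_rl p H : 0 < p -> tame H -> tame (rl p H).
Proof.
move=> p0 tH; split=> [u u0|y]; first exact: continuous_rl.
(* On ]0, y[, |I^p H| <= M I^p 1 = M u^p / Gamma(p + 1), increasing in u. *)
have [_ /(_ y)[M HM]] := tH; exists (M * ((Gamma (p + 1))^-1 * y `^ p)) =>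
  u u0 uy.
have M0 : 0 <= M.
  have := HM (u / 2); rewrite divr_gt0// => /(_ isT); move=> h.
  by apply: le_trans (h _) => //; rewrite (lt_trans _ uy)// ltr_pdivrMr//
    ltr_pMr// ltr1n.
apply: (le_trans (ler_norm_rl p0 (rl_defined_tame p0 u0 tH))).
apply: (@le_trans _ _ (rl p (fun=> M) u)).
  apply: le_rl => //; first by apply: rl_defined_tame => //; exact: tame_norm.
    by apply: rl_defined_tame => //; exact: tame_cst.
  by move=> v v0 vu; apply: HM => //; exact: lt_trans uy.
rewrite rl_cst// ler_wpM2l// /pown addrK ler_wpM2l//.
  by rewrite invr_ge0 ltW// Gamma_gt0// addr_gt0.
apply: ge0_ler_powR; rewrite ?nnegrE ?(ltW p0) ?(ltW u0) ?(ltW uy)//.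
by rewrite ltW// (lt_trans u0).
Qed.

(** Each [rl] is a convolution divided by Gamma, so [convA] applies, and the constants cancel
    because Beta(p, q) Gamma(p + q) = Gamma p Gamma q. *)
Lemma rl_semigroup_ge0 p q H y : 0 < p -> 0 < q -> 0 < y -> tame H ->
  (forall u : R, 0 < u -> 0 <= H u) -> rl p (rl q H) y = rl (p + q) H y.
Proof.
move=> p0 q0 y0 tH H0.
have pq0 : 0 < p + q by rewrite addr_gt0.
have dJ : rl_defined p (rl q H) y by apply: rl_defined_tame => //; exact: tame_rl.
have dH : rl_defined (p + q) H y by exact: rl_defined_tame.
have mH : measurable_fun [set: R] (cut H).
  by apply: measurable_cut => u; rewrite in_itv/= andbT => u0;
    have [+ _] := tH; apply.
have E u : cut (rl q H) u = ((Gamma q)^-1%:E * conv (pw q) (cut H) u)%E.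
  rewrite cutE; case: ifPn => [u0|].
    rewrite conv_pw_cut_rl//; last exact: rl_defined_tame.
    by rewrite -EFinM mulrA mulVf ?mul1r// gt_eqF// Gamma_gt0.
  by rewrite -leNgt => u0; rewrite conv_pw_cut set_itv_ge ?integral_set0
    ?mule0// bnd_simp -leNgt.
have := conv_pw_cut_rl p0 dJ.
have -> : conv (pw p) (cut (rl q H)) y =
    ((Gamma q)^-1%:E * conv (pw p) (conv (pw q) (cut H)) y)%E.
  rewrite /conv -ge0_integralZl//.
  - by apply: eq_integral => u _; rewrite E muleCA.
  - apply: emeasurable_funM; first by apply: measurable_fun_subl;
      exact: measurable_pw.
    by apply: measurable_conv => //; [exact: measurable_pw|exact: pw_ge0|
      exact: cut_ge0].
  - move=> u _; rewrite mule_ge0 ?pw_ge0//; apply: conv_ge0;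
      [exact: pw_ge0|exact: cut_ge0].
  - by rewrite lee_fin invr_ge0 ltW// Gamma_gt0.
rewrite convA//; [|exact: measurable_pw|exact: measurable_pw|
  exact: pw_ge0|exact: pw_ge0|exact: cut_ge0].
have -> : conv (conv (pw p) (pw q)) (cut H) y =
    ((Beta p q)%:E * conv (pw (p + q)) (cut H) y)%E.
  rewrite /conv -ge0_integralZl//.
  - apply: eq_integral => u _; rewrite muleA -conv_pwE//.
  - apply: emeasurable_funM => //; apply: measurable_fun_subl;
      exact: measurable_pw.
  - by move=> u _; rewrite mule_ge0 ?pw_ge0//; exact: cut_ge0.
  - by rewrite lee_fin /Beta divr_ge0 ?mulr_ge0// ltW// Gamma_gt0.
rewrite conv_pw_cut_rl// -!EFinM => -[E2].
have Gp := Gamma_gt0 p0; have Gq := Gamma_gt0 q0; have Gpq := Gamma_gt0 pq0.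
apply: (mulfI (lt0r_neq0 Gp)); rewrite -E2 /Beta.
move: (Gamma p) (Gamma q) (Gamma (p + q)) (rl _ _ _) Gp Gq Gpq.
by move=> x1 x2 x3 x4 ? ? ?; field; rewrite !gt_eqF.
Qed.

(** Linearity, applied to the nonnegative tame functions |H| and |H| - H. *)
Lemma rl_semigroup p q H y : 0 < p -> 0 < q -> 0 < y -> tame H ->
  rl p (rl q H) y = rl (p + q) H y.
Proof.
move=> p0 q0 y0 tH; pose H2 u := `|H u| - H u.
have tH1 : tame (fun u => `|H u|) by exact: tame_norm.
have tH2 : tame H2 by apply: tameD => //; exact: tameN.
have H20 u : 0 < u -> 0 <= H2 u by rewrite subr_ge0 ler_norm.
have E r u : 0 < r -> 0 < u -> rl r H u = rl r (fun u => `|H u|) u - rl r H2 u.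
  move=> r0 u0; rewrite -rlB; [|exact: rl_defined_tame..].
  by apply: eq_rl => v _ _; rewrite /H2 opprB addrC subrK.
rewrite E ?addr_gt0// -!(rl_semigroup_ge0 p0 q0)//.
rewrite -rlB; [|by apply: rl_defined_tame => //; exact: tame_rl..].
by apply: eq_rl => u u0 _; exact: E.
Qed.

Lemma is_derive_rl1 K y : 0 < y -> (forall u : R, 0 < u -> {for u, continuous
  K}) ->
  (forall x : R, 0 < x -> rl_defined 1 K x) -> is_derive y 1 (rl 1 K) (K y).
Proof.
move=> y0 cK dK.
have kernE x : kern 1 K x = K by apply/funext => u;
  rewrite /kern subrr powRr0 mul1r.
(* The hypothesis speaks of open intervals; its instance at [x + 1] includes the endpoint [x]. *)
have iK (x : R) : 0 < x -> mu.-integrable `]0, x] (EFin \o K).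
  move=> x0; apply: (@integrableS _ _ _ mu `]0, (x + 1)[%classic) => //.
    by move=> u /=; rewrite !in_itv/= => /andP[-> ux]/=;
      rewrite (le_lt_trans ux)// ltrDl.
  by have := dK _ (addr_gt0 x0 ltr01); rewrite /rl_defined kernE.
have yy1 : y < y + 1 by rewrite ltrDl.
have [dF FE] := @continuous_FTC1 R K (BRight 0) y (y + 1)
  yy1 (iK _ (addr_gt0 y0 ltr01)) y0 (cK _ y0).
apply: (@near_eq_is_derive _ _ _ (fun x : R => \int[mu]_(t in `]0, x]) K t : R)).
  near=> x; have x0 : 0 < x by near: x; exact: lt_nbhsr.
  rewrite /rl Gamma1 invr1 mul1r kernE Rintegral_itv_bndo_bndc//.
  by have := dK _ x0; rewrite /rl_defined kernE.
exact: (DeriveDef dF (etrans (esym (derive1E _ _)) FE)).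
Unshelve. all: by end_near. Qed.

(** Near [y], I^(p+1) H = I^1 (I^p H) with I^p H continuous. *)
Lemma is_derive_rlS p H y : 0 < p -> 0 < y -> tame H ->
  is_derive y 1 (rl (p + 1) H) (rl p H y).
Proof.
move=> p0 y0 tH; have tJ := tame_rl p0 tH; have [cJ _] := tJ.
apply: (@near_eq_is_derive _ _ _ (rl 1 (rl p H))); last first.
  by apply: is_derive_rl1 => // x x0; exact: rl_defined_tame.
near=> x; have x0 : 0 < x by near: x; exact: lt_nbhsr.
by rewrite (rl_semigroup ltr01 p0 x0 tH) addrC.
Unshelve. all: by end_near. Qed.

Section inversion.
Variables (F0 : R) (F1 : R -> R) (d : R).
Hypotheses (tF1 : tame F1) (d1 : d < 1).

Definition primitive u : R := F0 + rl 1 F1 u.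

(* The Riemann-Liouville derivative of order [d] of [primitive]. *)
Definition rl_derivative u : R := F0 * pown (1 - d) u + rl (1 - d) F1 u.

Let d'0 : 0 < 1 - d. Proof. by rewrite subr_gt0. Qed.

Lemma tame_primitive : tame primitive.
Proof. by apply: tameD; [exact: tame_cst|exact: tame_rl]. Qed.

Lemma continuous_rl_derivative u : 0 < u -> {for u, continuous rl_derivative}.
Proof.
move=> u0; apply: cvgD; last exact: continuous_rl.
by apply: cvgM; [exact: cvg_cst|exact: continuous_pown].
Qed.

(** For d > 0 the power k_(1-d) is not bounded near 0, so the power and the tame part are integrated
    separately. *)
Lemma rl_defined_rl_derivative p y : 0 < p -> 0 < y -> rl_defined p
  rl_derivative y.
Proof.
move=> p0 y0; apply: rl_definedD; first by apply: rl_definedZ;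
  exact: rl_defined_pown.
by apply: rl_defined_tame => //; exact: tame_rl.
Qed.

(** Serves twice: p = 1 identifies a derivative, and p = d undoes it. *)
Lemma rl_rl_derivative p y : 0 < p -> 0 < y ->
  rl p rl_derivative y = F0 * pown (p + (1 - d)) y + rl (p + (1 - d)) F1 y.
Proof.
move=> p0 y0; rewrite rlD; last 2 first.
- by apply: rl_definedZ; exact: rl_defined_pown.
- by apply: rl_defined_tame => //; exact: tame_rl.
rewrite rlZ; last exact: rl_defined_pown.
by rewrite rl_pown// rl_semigroup.
Qed.

(** Both I^(1-d) of [primitive] and I^1 of [rl_derivative] equal F0 k_(2-d) + I^(2-d) F1, and the
    latter has the derivative [rl_derivative]. *)
Lemma is_derive_rl_primitive y : 0 < y ->
  is_derive y 1 (rl (1 - d) primitive) (rl_derivative y).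
Proof.
move=> y0; apply: (@near_eq_is_derive _ _ _ (rl 1 rl_derivative)); last first.
  apply: is_derive_rl1 => //; first exact: continuous_rl_derivative.
  by move=> x; exact: rl_defined_rl_derivative.
near=> x; have x0 : 0 < x by near: x; exact: lt_nbhsr.
rewrite rl_rl_derivative// /primitive rlD; last 2 first.
- by apply: rl_defined_tame => //; exact: tame_cst.
- by apply: rl_defined_tame => //; exact: tame_rl.
by rewrite (rl_cst _ d'0 x0) (rl_semigroup d'0 ltr01 x0 tF1) (addrC 1).
Unshelve. all: by end_near. Qed.

Lemma rl_rl_derivative_primitive y : 0 < d -> 0 < y -> rl d rl_derivative y =
  primitive y.
Proof.
move=> d0 y0; rewrite (rl_rl_derivative d0 y0) (_ : d + (1 - d) = 1);
  last by ring.
by rewrite pown1 mulr1.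
Qed.

Lemma rl_derivative0 u : d = 0 -> rl_derivative u = primitive u.
Proof. by move=> d0; rewrite /rl_derivative /primitive d0 subr0 pown1 mulr1. Qed.

End inversion.
End RiemannLiouville.

(** * Change of variable in the psi-fractional operators *)

Section RelativeChainRule.
Context {R : realType}.
Implicit Types (A : set R) (h H th : R -> R).

(** A chain rule with a derivative relative to [A] inside and an ordinary one outside.
    Caratheodory's form H v - H (th x) = g v (v - th x) avoids dividing by an increment of [th]. *)
Lemma cvg_diff_quotient_comp A h H th x (H1 th1 : R) : A x ->
  (forall t, A t -> h t = H (th t)) -> is_derive (th x) 1 H H1 ->
  diff_quotient th x y @[y --> within A x^'] --> th1 ->
  diff_quotient h x y @[y --> within A x^'] --> H1 * th1.
Proof.
move=> Ax hH /is_derive1_caratheodory[g [gE cg gx]] dth.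
have cid : y @[y --> within A x^'] --> x.
  by apply: (@cvg_trans _ x^'); exact: cvg_within.
have idE y : y != x -> th y = th x + diff_quotient th x y * (y - x).
  by move=> yx; rewrite /diff_quotient divfK ?subr_eq0// addrC subrK.
have nx : \forall y \near within A x^', y != x.
  apply: cvg_within; exact: withinT.
have cth : th y @[y --> within A x^'] --> th x.
  have : th x + diff_quotient th x y * (y - x) @[y --> within A x^'] --> th x +
    th1 * (x - x).
    apply: cvgD; first exact: cvg_cst.
    by apply: cvgM => //; apply: cvgB => //; exact: cvg_cst.
  rewrite subrr mulr0 addr0; apply: cvg_trans; apply: near_eq_cvg.
  by apply: filterS nx => y /idE ->.
have : g (th y) * diff_quotient th x y @[y --> within A x^'] --> H1 * th1.
  by apply: cvgM => //; rewrite -gx; exact: (cvg_comp _ _ cth cg).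
apply: cvg_trans; apply: near_eq_cvg; near=> y.
have Ay : A y by near: y; exact: withinT.
by rewrite /diff_quotient !hH// gE mulrA.
Unshelve. all: by end_near. Qed.
End RelativeChainRule.

Section ChangeOfVariable.
Context {R : realType}.
Local Notation mu := (@lebesgue_measure R).
Variables (A : set R) (I : R -> set R) (th th1 w : R -> R).
Implicit Types (h H F : R -> R) (x y p : R).

(* [A] is the half-open domain of the operators, [I x] the range of integration at
   [x], [th] the substitution, [th1] its derivative and [w = psi' = |th1|]. *)
Record psi_change : Prop := PsiChange {
  th_gt0 : forall x, A x -> 0 < th x;
  sub_piece : forall x t, A x -> I x t -> A t;
  th_lt : forall x t, A x -> I x t -> th t < th x;
  open_piece : forall x, A x -> open (I x);
  continuous_th : forall x t, A x -> I x t -> {for t, continuous th};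
  continuous_weight : forall x t, A x -> I x t -> {for t, continuous w};
  weight_ge0 : forall x t, A x -> I x t -> 0 <= w t;
  transports_piece : forall x, A x -> transports (I x) `]0, th x[ th w;
  th1_neq0 : forall x, A x -> th1 x != 0;
  cvg_th1 : forall x, A x -> diff_quotient th x y @[y --> within A x^'] --> th1 x;
  proper_within : forall x, A x -> ProperFilter (within A x^') }.

Hypothesis cv : psi_change.

(** The constant in [th] drops out: the difference is psi x - psi t on the left and psi t - psi x on
    the right. *)
Definition gen_integrand p h x t : R := w t * (th x - th t) `^ (p - 1) * h t.

Definition gen_integral p h x : R :=
  if p == 0 then h x
  else (Gamma p)^-1 * \int[mu]_(t in I x) gen_integrand p h x t.

Definition gen_defined p h x : Prop :=
  p != 0 -> mu.-integrable (I x) (EFin \o gen_integrand p h x).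

(** On the right side [th1] is -psi', which absorbs the minus sign of the right derivative. *)
Definition gen_derive h x : R := derive_on A h x / th1 x.

Definition gen_deriven n h : R -> R := iter n gen_derive h.

(** The kernel of [rl] at [th x], transported by [th], is the present integrand. Asking for
    [rl_defined] rather than [tame] keeps the lemma applicable to [rl_derivative]. *)
Lemma gen_integral_rl p h H x : A x -> 0 < p -> (forall t, A t -> h t = H (th
  t)) ->
  (forall u : R, 0 < u -> {for u, continuous H}) -> rl_defined p H (th x) ->
  gen_defined p h x /\ gen_integral p h x = rl p H (th x).
Proof.
move=> Ax p0 hH cH dH.
have thI t : I x t -> `]0, th x[%classic (th t).
  move=> It; rewrite /= in_itv/= (th_lt cv Ax It) andbT.
  by apply: (th_gt0 cv); exact: (sub_piece cv Ax It).
have ck u : `]0, th x[%classic u -> {for u, continuous (kern p H (th x))}.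
  exact: continuous_kern.
have oJ : open `]0, th x[%classic by exact: interval_open.
have [i1 i2] := transports_integrable (open_piece cv Ax) oJ
  (transports_piece cv Ax) thI (fun t => @weight_ge0 cv x t Ax)
  (fun t => @continuous_th cv x t Ax) (fun t => @continuous_weight cv x t Ax)
    ck dH.
have E t : I x t -> kern p H (th x) (th t) * w t = gen_integrand p h x t.
  by move=> It; rewrite /kern /gen_integrand (hH _ (sub_piece cv Ax It)); ring.
split.
  move=> _; apply: eq_integrable i1; first by apply: open_measurable;
    exact: open_piece cv _ Ax.
  by move=> t /set_mem It; rewrite /= E.
rewrite /gen_integral gt_eqF// /rl -i2; congr (_ * _).
by apply: eq_Rintegral => t /set_mem It; rewrite E.
Qed.

Lemma gen_derive_comp h H x (H1 : R) : A x -> (forall t, A t -> h t = H (th t)) ->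
  is_derive (th x) 1 H H1 -> derivable_on A h x /\ gen_derive h x = H1.
Proof.
move=> Ax hH dH.
have := cvg_diff_quotient_comp Ax hH dH (cvg_th1 cv Ax).
have := proper_within cv Ax => pA l; split; first by apply/cvg_ex; eexists;
  exact: l.
rewrite /gen_derive /derive_on (cvg_lim _ l)//.
by rewrite mulfK// (th1_neq0 cv).
Qed.

Section hilfer.
Variables (n : nat) (alpha beta F0 : R) (F1 f : R -> R).
Hypotheses (halpha : 0 < alpha) (hn : n%:R - 1 < alpha < n%:R).
Hypotheses (hbeta : 0 <= beta <= 1) (tF1 : tame F1).
Hypothesis hf : forall t, A t -> f t = primitive F0 F1 (th t).

Let d := beta * (n%:R - alpha).
Let c := (1 - beta) * (n%:R - alpha).
Let P := primitive F0 F1.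
Let tP : tame P. Proof. exact: tame_primitive. Qed.

Let d_ge0 : 0 <= d.
Proof. by move: hn hbeta => /andP[? ?] /andP[? ?];
  rewrite mulr_ge0// subr_ge0 ltW. Qed.

Let c_ge0 : 0 <= c.
Proof. by move: hn hbeta => /andP[? ?] /andP[? ?];
  rewrite mulr_ge0// subr_ge0// ltW. Qed.

Let d_lt1 : d < 1.
Proof.
move: hn hbeta => /andP[? ?] /andP[? ?]; apply: (@le_lt_trans _ _ (n%:R - alpha)).
  by rewrite /d ler_piMl// subr_ge0 ltW.
by rewrite ltrBlDr -ltrBlDl.
Qed.

Let cdE : c + alpha = n%:R - d. Proof. by rewrite /c /d; ring. Qed.

Let n_gt0 : (0 < n)%N.
Proof. by move: hn => /andP[_ an]; rewrite -(ltr0n R) (lt_trans halpha). Qed.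

Lemma gen_defined_tame y : A y ->
  gen_defined alpha f y /\ gen_integral alpha f y = rl alpha P (th y).
Proof.
move=> Ay; have [cP _] := tP; apply: gen_integral_rl => //.
by apply: rl_defined_tame => //; exact: (th_gt0 cv).
Qed.

Let h := gen_integral alpha f.
Let g := gen_integral c h.

Lemma gen_integralc y : A y -> gen_defined c h y /\ g y = rl (n%:R - d) P (th y).
Proof.
move=> Ay; have th0 := th_gt0 cv Ay.
(* For c = 0 the operator is the identity and alpha itself equals n - d. *)
have [c0|c0] := eqVneq c 0.
  rewrite /gen_defined c0 eqxx; split => //.
  rewrite /g /gen_integral c0 eqxx -cdE c0 add0r.
  by have [_] := gen_defined_tame Ay.
have cp : 0 < c by rewrite lt_neqAle eq_sym c0.
have tJ := tame_rl halpha tP; have [cJ _] := tJ.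
have [] := @gen_integral_rl c h (rl alpha P) y Ay cp.
- by move=> t At; have [_] := gen_defined_tame At.
- exact: cJ.
- exact: rl_defined_tame.
by move=> dh gE; split; rewrite // -cdE -rl_semigroup.
Qed.

(** The strict bound keeps the order n - d - (k + 1) at 1 - d or above, hence positive; for k + 1 =
    n it would be -d. *)
Lemma is_derive_rl_step k (u : R) : (k.+1 < n)%N -> 0 < u ->
  is_derive u 1 (rl (n%:R - d - k%:R) P) (rl (n%:R - d - k.+1%:R) P u).
Proof.
move=> kn u0; have -> : n%:R - d - k%:R = n%:R - d - k.+1%:R + 1 by
  rewrite -natr1; ring.
apply: is_derive_rlS => //.
have : (k.+2%:R : R) <= n%:R by rewrite ler_nat.
rewrite -(natr1 k.+1); move: d_lt1; set e : R := k.+1%:R; set b : R := n%:R.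
by move=> ? ?; lra.
Qed.

Lemma gen_deriven_rl k y : (k < n)%N -> A y -> gen_deriven k g y = rl (n%:R - d
  - k%:R) P (th y).
Proof.
elim: k y => [|k IH] y kn Ay.
  by rewrite subr0; have [_] := gen_integralc Ay.
have [_] := gen_derive_comp Ay (fun t => IH t (ltnW kn)) (is_derive_rl_step kn
  (th_gt0 cv Ay)).
by [].
Qed.

(** After n - 1 derivatives the order is 1 - d, the one handled by [is_derive_rl_primitive]. *)
Lemma gen_deriven_last y : A y ->
  derivable_on A (gen_deriven n.-1 g) y /\ gen_deriven n g y = rl_derivative F0
    F1 d (th y).
Proof.
move=> Ay; rewrite -{2}(prednK n_gt0); apply: (@gen_derive_comp _ (rl (1 - d)
  P)) => //.
  have pn : (n.-1 < n)%N by rewrite prednK.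
  have nE : n%:R - d - n.-1%:R = 1 - d by rewrite -{1}(prednK n_gt0) -natr1; ring.
  by move=> t At; rewrite (gen_deriven_rl pn At) nE.
by apply: is_derive_rl_primitive => //; exact: (th_gt0 cv).
Qed.

Lemma gen_derivable k y : (k < n)%N -> A y -> derivable_on A (gen_deriven k g) y.
Proof.
move=> kn Ay; have [kn1|nk] := ltnP k.+1 n.
  have [//] := gen_derive_comp Ay (fun t => gen_deriven_rl (y := t) kn)
    (is_derive_rl_step kn1 (th_gt0 cv Ay)).
have -> : k = n.-1 by apply/eqP; rewrite eqn_leq -ltnS prednK// kn -ltnS prednK.
by have [] := gen_deriven_last Ay.
Qed.

Lemma gen_hilfer x : A x ->
  gen_defined d (gen_deriven n g) x /\ gen_integral d (gen_deriven n g) x = f x.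
Proof.
move=> Ax; have th0 := th_gt0 cv Ax.
have E t : A t -> gen_deriven n g t = rl_derivative F0 F1 d (th t).
  by move=> At; have [_] := gen_deriven_last At.
(* For d = 0 the outer operator is the identity, and k_1 = 1 makes the last derivative already equal
   to [f]. *)
have [d0|d0] := eqVneq d 0.
  rewrite /gen_defined /gen_integral d0 eqxx; split=> //.
  by rewrite E// rl_derivative0// hf.
have dp : 0 < d by rewrite lt_neqAle eq_sym d0.
have [] := @gen_integral_rl d _ (rl_derivative F0 F1 d) x Ax dp E.
- by move=> u; exact: continuous_rl_derivative.
- exact: rl_defined_rl_derivative.
by move=> ? ->; rewrite rl_rl_derivative_primitive// hf.
Qed.

End hilfer.
End ChangeOfVariable.

(** * Derivatives relative to an interval *)

Section RelativeDerivative.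
Context {R : realType}.
Local Notation mu := (@lebesgue_measure R).
Implicit Types (h k th : R -> R) (a b x : R).

Lemma cvg_interior (A : set R) h x (l : R) : nbhs x A ->
  h y @[y --> within A x^'] --> l -> h y @[y --> x^'] --> l.
Proof.
move=> nA; apply: cvg_trans; apply: cvg_app => P HP.
change (nbhs x (fun y => y != x -> P y)).
have {}HP : nbhs x (fun y => y != x -> A y -> P y) by exact: HP.
by apply: filterS2 HP nA => y H Ay yx; exact: H.
Qed.

(** The difference quotient, completed by its limit at [x], is the continuous factor of
    Caratheodory's criterion. *)
Lemma is_derive_interior a b h x : x \in `]a, b[ -> derivable_on `[a, b] h x ->
  is_derive x 1 h (derive_on `[a, b] h x).
Proof.
move=> xab dh; set l := derive_on _ h x.
have nB : nbhs x `[a, b]%classic.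
  by apply: filterS (near_in_itvoo xab) => y; exact: subset_itv_oo_cc.
have hl : diff_quotient h x y @[y --> x^'] --> l by apply: cvg_interior nB _;
  exact: dh.
apply/is_derive1_caratheodory; exists (fun z => if z == x then l else
  diff_quotient h x z).
split; last by rewrite eqxx.
  move=> z; case: eqP => [->|/eqP zx]; first by rewrite !subrr mulr0.
  by rewrite /diff_quotient divfK// subr_eq0.
apply/continuous_withinNx; rewrite eqxx; apply: cvg_trans hl; apply: near_eq_cvg.
by near=> z; rewrite ifF//; apply/negbTE; near: z; exact: nbhs_dnbhs_neq.
Unshelve. all: by end_near. Qed.

(** Passes from the closed interval of the hypotheses to the half-open domain of the operators. *)
Lemma cvg_diff_quotient_subset (A B : set R) h x : A `<=` B -> derivable_on B h
  x ->
  diff_quotient h x y @[y --> within A x^'] --> derive_on B h x.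
Proof.
move=> AB dh; have {}dh : diff_quotient h x y @[y --> within B x^'] -->
  derive_on B h x by exact: dh.
apply: cvg_trans dh; apply: cvg_app => P HP.
change (nbhs x (fun y => y != x -> A y -> P y)).
have {}HP : nbhs x (fun y => y != x -> B y -> P y) by exact: HP.
by apply: filterS HP => y H yx Ay; apply: H => //; exact: AB.
Qed.

(** Points just to the left of [x] lie in the interval, also when [x = b]. Properness makes the
    limit defining [derive_on] unique. *)
Lemma proper_within_itvoc a b x : x \in `]a, b] -> ProperFilter (within `]a, b]
  x^').
Proof.
rewrite in_itv/= => /andP[ax xb]; apply: Build_ProperFilter => H.
have {}H : nbhs x (fun y => y != x -> `]a, b]%classic y -> False) by exact: H.
have : x^'- (set0 : set R).
  change (nbhs x (fun y => y < x -> False)).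
  apply: filterS2 H (lt_nbhsr ax) => y H ay yx; apply: H; first by rewrite lt_eqF.
  by rewrite /= in_itv/= ay (le_trans (ltW yx) xb).
exact: filter_not_empty.
Qed.

Lemma proper_within_itvco a b x : x \in `[a, b[ -> ProperFilter (within `[a, b[
  x^').
Proof.
rewrite in_itv/= => /andP[ax xb]; apply: Build_ProperFilter => H.
have {}H : nbhs x (fun y => y != x -> `[a, b[%classic y -> False) by exact: H.
have : x^'+ (set0 : set R).
  change (nbhs x (fun y => x < y -> False)).
  apply: filterS2 H (lt_nbhsl xb) => y H yb xy; apply: H; first by rewrite gt_eqF.
  by rewrite /= in_itv/= yb (le_trans ax (ltW xy)).
exact: filter_not_empty.
Qed.

Lemma derive_on_ge0 a b h x : x \in `]a, b[ -> derivable_on `[a, b] h x ->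
  {in `[a, b] &, {homo h : x y / x < y}} -> 0 <= derive_on `[a, b] h x.
Proof.
move=> xab dh hh.
have nB : nbhs x `[a, b]%classic.
  by apply: filterS (near_in_itvoo xab) => y; exact: subset_itv_oo_cc.
have hl : diff_quotient h x y @[y --> x^'] --> derive_on `[a, b] h x by
  apply: cvg_interior nB _; exact: dh.
rewrite -(cvg_lim _ hl)//; apply: limr_ge; first by apply/cvg_ex; eexists;
  exact: hl.
change (nbhs x (fun y => y != x -> 0 <= diff_quotient h x y)).
apply: filterS nB => y yB yx.
have xB : x \in `[a, b] by exact: subset_itv_oo_cc.
rewrite /diff_quotient; case: (ltgtP y x) yx => // [yx|xy] _.
  by rewrite -mulrNN -invrN !opprB divr_ge0 ?subr_ge0 ?(ltW yx)// ltW// hh.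
by rewrite divr_ge0 ?subr_ge0 ?(ltW xy)// ltW// hh.
Qed.

Lemma integral_derive_on a b h x z : a <= x -> x < z -> z <= b ->
  (forall t, t \in `[a, b] -> derivable_on `[a, b] h t) ->
  {within `[a, b], continuous h} -> {within `[a, b], continuous (derive_on `[a,
    b] h)} ->
  \int[mu]_(t in `]x, z[) derive_on `[a, b] h t = h z - h x.
Proof.
move=> ax xz zb dh ch cdh.
have sub : `[x, z]%classic `<=` `[a, b]%classic.
  by move=> t /=; rewrite !in_itv/= => /andP[xt tz];
    rewrite (le_trans ax xt) (le_trans tz zb).
have cdxz := continuous_subspaceW sub cdh;
  have cxz := continuous_subspaceW sub ch.
have int t : t \in `]x, z[ -> t \in `]a, b[.
  by rewrite !in_itv/= => /andP[xt tz]; rewrite (le_lt_trans ax xt)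
    (lt_le_trans tz zb).
have dint t : t \in `]x, z[ -> is_derive t 1 h (derive_on `[a, b] h t).
  by move=> /int tab; apply: is_derive_interior => //; apply: dh;
    exact: subset_itv_oo_cc.
have := @continuous_FTC2 R (derive_on `[a, b] h) h x z xz cdxz.
rewrite /Rintegral integral_itv_bndoo; last first.
  apply: open_continuous_measurable_EFin; first exact: interval_open.
  by move=> t /= txz; exact: within_continuous_continuous xz cdxz txz.
move=> ->//.
  have /continuous_within_itvP-/(_ xz)[_ ? ?] := cxz; split => //.
  by move=> t /dint[].
by move=> t /dint dt; rewrite derive1E derive_val.
Qed.

End RelativeDerivative.

(** * Extension of functions of the new variable beyond the segment *)

Section Extension.
Context {R : realType}.
Implicit Types (h k th : R -> R) (a b x : R).

Lemma cvg_within_mem (T : Type) (F : set_system T) {FF : Filter F} (S : set R)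
  (h : T -> R) (l : R) :
  h t @[t --> F] --> l -> (forall t, S (h t)) -> h t @[t --> F] --> within S
    (nbhs l).
Proof.
move=> hl hS P HP.
have H : F (fun t => S (h t) -> P (h t)) by exact: hl _ HP.
change (F (fun t => P (h t))).
by apply: filterS H => t; apply; exact: hS.
Qed.

(** For 0 <= d, the nearest-point projection onto [0, d]; composing with it extends a function by
    its end values. *)
Definition clamp (d u : R) := Num.max 0 (Num.min u d).

Lemma clamp_id d u : 0 <= u -> u <= d -> clamp d u = u.
Proof. by move=> u0 ud; rewrite /clamp min_l// max_r. Qed.

Lemma clamp_mem d u : 0 <= d -> `[0, d]%classic (clamp d u).
Proof. by move=> d0; rewrite /clamp /= in_itv/= le_max lexx/= ge_max d0 ge_min
  lexx orbT. Qed.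

Lemma continuous_clamp d : continuous (clamp d).
Proof.
move=> u; have c0 : {for u, continuous (@cst R R^o 0)} by exact: cst_continuous.
have cd : {for u, continuous (@cst R R^o d)} by exact: cst_continuous.
have ci : {for u, continuous (@idfun R : R -> R^o)} by exact: cvg_id.
exact: continuous_max c0 (continuous_min ci cd).
Qed.

(** [F1] is k composed with the inverse of [th] and with [clamp]; it is bounded because [k] attains
    its extrema on [a, b]. Continuity of the inverse is a hypothesis since [th] increases on one
    side and decreases on the other. *)
Lemma tame_extension a b d th k : a <= b -> 0 <= d ->
  {within `[a, b], continuous k} ->
  {in `[a, b] &, injective th} -> th @` `[a, b] = `[0, d]%classic ->
  (forall g, {in `[a, b], cancel th g} -> {within `[0, d], continuous g}) ->
  exists2 F1, tame F1 & forall t, t \in `[a, b] -> F1 (th t) = k t.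
Proof.
move=> ab d0 ck injth imth cinv.
pose g u := xget 0 [set t | t \in `[a, b] /\ th t = u].
have gK : {in `[a, b], cancel th g}.
  move=> t tab; rewrite /g; case: xgetP => [s _ [sab sE]|/(_ t)];
    first exact: injth.
  by case.
have /subspace_continuousP cg := cinv _ gK.
have gB u : `[0, d]%classic u -> `[a, b]%classic (g u).
  by rewrite -imth => -[t tab <-]; rewrite gK.
have /subspace_continuousP ck' := ck.
exists (fun u => k (g (clamp d u))); last first.
  move=> t tab; have : `[0, d]%classic (th t) by rewrite -imth; exists t.
  by rewrite /= in_itv/= => /andP[? ?]; rewrite clamp_id// gK.
split=> [u u0|y].
  have c1 : clamp d v @[v --> u] --> within `[0, d]%classic (nbhs (clamp d u)).
    by apply: cvg_within_mem; [exact: continuous_clamp|move=> v;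
      exact: clamp_mem].
  have c2 : g (clamp d v) @[v --> u] --> within `[a, b]%classic (nbhs (g (clamp
    d u))).
    apply: cvg_within_mem; last by move=> v; apply: gB; exact: clamp_mem.
    exact: cvg_comp _ _ c1 (cg _ (clamp_mem _ d0)).
  exact: cvg_comp _ _ c2 (ck' _ (gB _ (clamp_mem _ d0))).
have [m _ mP] := EVT_min ab ck; have [M _ MP] := EVT_max ab ck.
exists (`|k m| + `|k M|) => u _ _.
have guB := gB _ (clamp_mem u d0); have := mP _ guB; have := MP _ guB.
move: (ler_norm (k M)) (normr_ge0 (k M)) (normr_ge0 (k m)) (ler_norm (- k m)).
by rewrite normrN ler_norml => ? ? ? ? ? ?; apply/andP; split; lra.
Qed.

End Extension.

(** * The left and right operators *)

Section TwoSides.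
Context {R : realType}.
Local Notation mu := (@lebesgue_measure R).
Variables (a b : R) (psi : R -> R).
Hypothesis ab : a < b.
Hypothesis dpsi : forall x, x \in `[a, b] -> derivable_on `[a, b] psi x.
Hypothesis cpsi : {within `[a, b], continuous psi}.
Hypothesis cdpsi : {within `[a, b], continuous (derive_on `[a, b] psi)}.
Hypothesis hincr : {in `[a, b] &, {homo psi : x y / x < y}}.
Hypothesis hpsi' : forall x, x \in `[a, b] -> derive_on `[a, b] psi x != 0.

Let psi' := derive_on `[a, b] psi.
Let aB : a \in `[a, b]. Proof. by rewrite bound_itvE ltW. Qed.
Let bB : b \in `[a, b]. Proof. by rewrite bound_itvE ltW. Qed.

Let dpsi_in t : t \in `]a, b[ -> is_derive t 1 psi (psi' t).
Proof. by move=> tab; apply: is_derive_interior => //; apply: dpsi;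
  exact: subset_itv_oo_cc. Qed.

Let cpsi_in t : t \in `]a, b[ -> {for t, continuous psi}.
Proof. exact: within_continuous_continuous ab cpsi. Qed.

Let cdpsi_in t : t \in `]a, b[ -> {for t, continuous psi'}.
Proof. exact: within_continuous_continuous ab cdpsi. Qed.

Let psi'_ge0 t : t \in `]a, b[ -> 0 <= psi' t.
Proof. by move=> tab; apply: derive_on_ge0 => //; apply: dpsi;
  exact: subset_itv_oo_cc. Qed.

Lemma image_psi_itvoo x z : a <= x -> x < z -> z <= b ->
  psi @` `]x, z[ = `]psi x, psi z[%classic.
Proof.
move=> ax xz zb.
have sub t : t \in `[x, z] -> t \in `[a, b].
  by rewrite !in_itv/= => /andP[xt tz]; rewrite (le_trans ax xt) (le_trans tz zb).
have hxz : {in `[x, z] &, {homo psi : s t / s < t}} by move=> s t /sub sB /sub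
  tB; exact: hincr.
apply/seteqP; split; first exact: increasing_image_oo.
move=> v /=; rewrite in_itv/= => /andP[xv vz].
have cxz : {within `[x, z], continuous psi} by apply: continuous_subspaceW cpsi
  => t /sub.
have [|c] := @IVT R psi x z v (ltW xz) cxz.
  by rewrite min_l ?max_r ?(ltW xv) ?(ltW vz)// ltW// (lt_trans xv).
rewrite in_itv/= !le_eqVlt => /andP[/predU1P[<-|xc]]; first by move=> _ E;
  rewrite E ltxx in xv.
move=> /predU1P[->|cz] E; first by rewrite E ltxx in vz.
by exists c => //=; rewrite in_itv/= xc.
Qed.

Lemma image_psi_itvcc : psi @` `[a, b] = `[psi a, psi b]%classic.
Proof.
have leB := ltW_homo_in hincr.
apply/seteqP; split => [_ [t /= tab <-]|v /=].
  by move: (tab); rewrite !in_itv/= => /andP[at_ tb]; rewrite !leB.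
rewrite in_itv/= => vab; have [|c cab <-] := @IVT R psi a b v (ltW ab) cpsi;
  last by exists c.
by rewrite min_l ?max_r// leB// ltW.
Qed.

Let injpsi : {in `[a, b] &, injective psi}.
Proof.
move=> s t sB tB E; case: (ltgtP s t) => // st.
  by have := hincr sB tB st; rewrite E ltxx.
by have := hincr tB sB st; rewrite E ltxx.
Qed.

Section left.
Let A := `]a, b]%classic.
Let I (x : R) := `]a, x[%classic : set R.
Let th t := psi t - psi a.

Let AB x : A x -> x \in `[a, b].
Proof. exact: subset_itv_oc_cc. Qed.

Let IB x t : A x -> I x t -> t \in `]a, b[.
Proof.
by rewrite /A /I /= !in_itv/= => /andP[ax xb] /andP[-> tx];
  rewrite (lt_le_trans tx xb).
Qed.

Lemma psi_change_left : psi_change A I th psi' psi'.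
Proof.
split.
- move=> x Ax; rewrite subr_gt0; apply: hincr => //; first exact: AB.
  by move: Ax; rewrite /A /= in_itv/= => /andP[].
- by move=> x t Ax /(IB Ax); exact: subset_itv_oo_oc.
- move=> x t Ax It; rewrite ltrD2r; apply: hincr; last by move: It;
    rewrite /I /= in_itv/= => /andP[].
    by apply: subset_itv_oo_cc; exact: IB Ax It.
  exact: AB.
- by move=> x _; exact: interval_open.
- by move=> x t Ax It; apply: cvgB; [apply: cpsi_in;
    exact: IB Ax It|exact: cvg_cst].
- by move=> x t Ax It; apply: cdpsi_in; exact: IB Ax It.
- by move=> x t Ax It; apply: psi'_ge0; exact: IB Ax It.
- move=> x Ax G hG; have := Ax; rewrite /A /= in_itv/= => /andP[ax xb].
  have im : th @` `]a, x[ = `]0, th x[%classic.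
    have := image_psi_itvoo (lexx a) ax xb => E.
    apply/seteqP; split => [_ [t tax <-]|u /=].
      have : (psi @` `]a, x[) (psi t) by exists t.
      by rewrite E /= !in_itv/= subr_gt0 ltrD2r.
    rewrite in_itv/= => /andP[u0 ux].
    have : `]psi a, psi x[%classic (u + psi a) by rewrite /= in_itv/= ltrDr u0
      -ltrBrDr.
    by rewrite -E => -[t tax tE]; exists t; rewrite // /th tE addrK.
  have dth t : t \in `]a, x[ -> is_derive t 1 th (psi' t).
    by move=> /(IB Ax)/dpsi_in dt; rewrite -[X in is_derive _ _ _ X]subr0;
      exact: is_deriveB.
  have inJ t : t \in `]a, x[ -> `]0, th x[%classic (th t) by move=> tax;
    rewrite -im; exists t.
  rewrite -im; apply: (ge0_substitution_increasing_oo ax dth).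
  + by move=> t tax; apply: cdpsi_in; exact: IB Ax tax.
  + by move=> t /inJ/hG[].
  + by move=> t /inJ/hG[].
  + move=> s t sI tI st; rewrite ltrD2r; apply: hincr => //.
      by apply: subset_itv_oo_cc; exact: IB Ax sI.
    by apply: subset_itv_oo_cc; exact: IB Ax tI.
  + by move=> t tax; apply: psi'_ge0; exact: IB Ax tax.
- by move=> x Ax; apply: hpsi'; exact: AB.
- move=> x Ax; rewrite (_ : diff_quotient th x = diff_quotient psi x); last first.
    by apply/funext => y; rewrite /diff_quotient /th opprB addrA subrK.
  by apply: cvg_diff_quotient_subset; [move=> t; exact: AB|apply: dpsi;
    exact: AB].
- by move=> x Ax; exact: proper_within_itvoc.
Qed.

(** In the variable u = th t the derivative of [f] is f' / psi', and [F1] extends it. Transporting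
    I^1 F1 back gives the integral of psi' (f' / psi') = f' over ]a, t[. *)
Lemma primitive_left f : Cn_on 1 `[a, b] f ->
  exists2 F1, tame F1 & forall t, A t -> f t = primitive (f a) F1 (th t).
Proof.
move=> [df cf].
have {}df t : t \in `[a, b] -> derivable_on `[a, b] f t by exact: (df 0%N).
have cdf : {within `[a, b], continuous (derive_on `[a, b] f)} by exact: (cf 1%N).
have {}cf : {within `[a, b], continuous f} by exact: (cf 0%N).
have [] := @tame_extension R a b (th b) th (fun t => derive_on `[a, b] f t /
  psi' t) (ltW ab).
- by rewrite subr_ge0 ltW// hincr.
- apply/subspace_continuousP => x xB; apply: cvgM.
    by have /subspace_continuousP := cdf; apply.
  by apply: cvgV; [exact: hpsi'|have /subspace_continuousP := cdpsi; apply].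
- by move=> s t sB tB /addIr; exact: injpsi.
- have E := image_psi_itvcc; apply/seteqP; split => [_ [t tab <-]|u /=].
    have : (psi @` `[a, b]) (psi t) by exists t.
    by rewrite E /= !in_itv/= subr_ge0 lerD2r.
  rewrite in_itv/= => /andP[u0 ux].
  have : `[psi a, psi b]%classic (u + psi a) by rewrite /= in_itv/= lerDr u0
    -lerBrDr.
  by rewrite -E => -[t tax tE]; exists t; rewrite // /th tE addrK.
- move=> g gK; have -> : 0 = th a by rewrite /th subrr.
  apply: segment_can_le_continuous gK; first exact: ltW.
  by move=> x; apply: cvgB; [exact: cpsi|exact: cvg_cst].
move=> F1 tF1 F1E; exists F1 => // t At; rewrite /primitive.
have cv := psi_change_left; have [cF1 _] := tF1.
have [_ <-] := @gen_integral_rl R A I th psi' psi' cv 1 (F1 \o th) F1 t At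
  ltr01 (fun _ _ => erefl)
  cF1 (rl_defined_tame ltr01 (th_gt0 cv At) tF1).
rewrite /gen_integral oner_eq0 Gamma1 invr1 mul1r.
rewrite (_ : \int[mu]_(s in I t) _ = f t - f a); first by rewrite addrC subrK.
have := At; rewrite /A /= in_itv/= => /andP[at_ tb].
rewrite -(integral_derive_on (lexx a) at_ tb df cf cdf);
  apply: eq_Rintegral => s /set_mem It.
have sB : s \in `[a, b] by apply: subset_itv_oo_cc; exact: IB At It.
by rewrite /gen_integrand subrr powRr0 mulr1 /= F1E// mulrC divfK// hpsi'.
Qed.

End left.

Section right.
Let A := `[a, b[%classic.
Let I (x : R) := `]x, b[%classic : set R.
Let th t := psi b - psi t.

Let AB x : A x -> x \in `[a, b].
Proof. exact: subset_itv_co_cc. Qed.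

Let IB x t : A x -> I x t -> t \in `]a, b[.
Proof.
by rewrite /A /I /= !in_itv/= => /andP[ax xb] /andP[xt ->];
  rewrite (le_lt_trans ax xt).
Qed.

(** Here [th] decreases, so its derivative and the weight differ by a sign, and the decreasing
    substitution is the one that applies. *)
Lemma psi_change_right : psi_change A I th (fun t => - psi' t) psi'.
Proof.
split.
- move=> x Ax; rewrite subr_gt0; apply: hincr => //; first exact: AB.
  by move: Ax; rewrite /A /= in_itv/= => /andP[].
- by move=> x t Ax /(IB Ax); exact: subset_itv_oo_co.
- move=> x t Ax It; rewrite ltrD2l ltrN2; apply: hincr; last by move: It;
    rewrite /I /= in_itv/= => /andP[].
    exact: AB.
  by apply: subset_itv_oo_cc; exact: IB Ax It.
- by move=> x _; exact: interval_open.
- by move=> x t Ax It; apply: cvgB; [exact: cvg_cst|apply: cpsi_in;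
    exact: IB Ax It].
- by move=> x t Ax It; apply: cdpsi_in; exact: IB Ax It.
- by move=> x t Ax It; apply: psi'_ge0; exact: IB Ax It.
- move=> x Ax G hG; have := Ax; rewrite /A /= in_itv/= => /andP[ax xb].
  have im : th @` `]x, b[ = `]0, th x[%classic.
    have := image_psi_itvoo ax xb (lexx b) => E.
    apply/seteqP; split => [_ [t tax <-]|u /=].
      have : (psi @` `]x, b[) (psi t) by exists t.
      by rewrite E /= !in_itv/= subr_gt0 ltrD2l ltrN2 andbC.
    rewrite in_itv/= => /andP[u0 ux].
    have : `]psi x, psi b[%classic (psi b - u) by rewrite /= in_itv/= gtrDl
      oppr_lt0 u0 andbT ltrBrDr addrC -ltrBrDr.
    by rewrite -E => -[t tax tE]; exists t; rewrite // /th tE subKr.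
  have dth t : t \in `]x, b[ -> is_derive t 1 th (- psi' t).
    by move=> /(IB Ax)/dpsi_in dt; rewrite -[X in is_derive _ _ _ X]sub0r;
      exact: is_deriveB.
  have inJ t : t \in `]x, b[ -> `]0, th x[%classic (th t) by move=> tax;
    rewrite -im; exists t.
  rewrite -im; have := ge0_substitution_decreasing_oo (G := G) xb dth => ->.
  + by apply: eq_integral => t _; rewrite opprK.
  + by move=> t tax; apply: cvgN; apply: cdpsi_in; exact: IB Ax tax.
  + by move=> t /inJ/hG[].
  + by move=> t /inJ/hG[].
  + move=> s t sI tI st; rewrite ltrD2l ltrN2; apply: hincr => //.
      by apply: subset_itv_oo_cc; exact: IB Ax tI.
    by apply: subset_itv_oo_cc; exact: IB Ax sI.
  + by move=> t tax; rewrite oppr_le0; apply: psi'_ge0; exact: IB Ax tax.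
- by move=> x Ax; rewrite oppr_eq0; apply: hpsi'; exact: AB.
- move=> x Ax; rewrite (_ : diff_quotient th x = \- diff_quotient psi x);
    last first.
    apply/funext => y; change (diff_quotient th x y = - diff_quotient psi x y).
    by rewrite /diff_quotient /th -mulNr; congr (_ / _); ring.
  by apply: cvgN; apply: cvg_diff_quotient_subset; [move=> t;
    exact: AB|apply: dpsi; exact: AB].
- by move=> x Ax; exact: proper_within_itvco.
Qed.

(** Now u = 0 corresponds to t = b, and the derivative in u is -f' / psi': the integral of -f' over
    ]t, b[ is f t - f b. *)
Lemma primitive_right f : Cn_on 1 `[a, b] f ->
  exists2 F1, tame F1 & forall t, A t -> f t = primitive (f b) F1 (th t).
Proof.
move=> [df cf].
have {}df t : t \in `[a, b] -> derivable_on `[a, b] f t by exact: (df 0%N).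
have cdf : {within `[a, b], continuous (derive_on `[a, b] f)} by exact: (cf 1%N).
have {}cf : {within `[a, b], continuous f} by exact: (cf 0%N).
have [] := @tame_extension R a b (th a) th (fun t => - (derive_on `[a, b] f t /
  psi' t)) (ltW ab).
- by rewrite subr_ge0 ltW// hincr.
- apply/subspace_continuousP => x xB; apply: cvgN; apply: cvgM.
    by have /subspace_continuousP := cdf; apply.
  by apply: cvgV; [exact: hpsi'|have /subspace_continuousP := cdpsi; apply].
- by move=> s t sB tB /addrI/oppr_inj; exact: injpsi.
- have E := image_psi_itvcc; apply/seteqP; split => [_ [t tab <-]|u /=].
    have : (psi @` `[a, b]) (psi t) by exists t.
    by rewrite E /= !in_itv/= subr_ge0 lerD2l lerN2 andbC.
  rewrite in_itv/= => /andP[u0 ux].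
  have : `[psi a, psi b]%classic (psi b - u) by rewrite /= in_itv/= gerDl
    oppr_le0 u0 andbT lerBrDr addrC -lerBrDr.
  by rewrite -E => -[t tax tE]; exists t; rewrite // /th tE subKr.
- move=> g gK; have -> : 0 = th b by rewrite /th subrr.
  apply: segment_can_ge_continuous gK; first exact: ltW.
  by move=> x; apply: cvgB; [exact: cvg_cst|exact: cpsi].
move=> F1 tF1 F1E; exists F1 => // t At; rewrite /primitive.
have cv := psi_change_right; have [cF1 _] := tF1.
have [_ <-] := @gen_integral_rl R A I th _ psi' cv 1 (F1 \o th) F1 t At ltr01
  (fun _ _ => erefl)
  cF1 (rl_defined_tame ltr01 (th_gt0 cv At) tF1).
rewrite /gen_integral oner_eq0 Gamma1 invr1 mul1r.
have := At; rewrite /A /= in_itv/= => /andP[at_ tb].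
have cdtb : {within `[t, b], continuous (derive_on `[a, b] f)}.
  by apply: continuous_subspaceW cdf => s /=;
    rewrite !in_itv/= => /andP[ts ->]; rewrite (le_trans at_ ts).
have idf : mu.-integrable `]t, b[ (EFin \o derive_on `[a, b] f).
  apply: (@integrableS _ _ _ mu `[t, b]%classic) => //;
    first exact: subset_itv_oo_cc.
  by apply: continuous_compact_integrable => //; exact: segment_compact.
rewrite (_ : \int[mu]_(s in I t) _ = -1 * (f b - f t)); first by ring.
rewrite -(integral_derive_on at_ tb (lexx b) df cf cdf) -RintegralZl//.
apply: eq_Rintegral => s /set_mem It.
have sB : s \in `[a, b] by apply: subset_itv_oo_cc; exact: IB At It.
rewrite /gen_integrand subrr powRr0 mulr1 /= F1E// mulrN mulN1r; congr (- _).
by rewrite mulrC divfK// hpsi'.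
Qed.

End right.
End TwoSides.

(** * The stated operators as instances of the common form *)

Section assembly.
Context {R : realType}.
Variables (a b : R) (psi : R -> R).
Implicit Types (h : R -> R) (p x : R) (k : nat).
Local Notation psi' := (derive_on `[a, b] psi).

Lemma left_integrandE p h x : left_integrand a b psi p h x =
  gen_integrand (fun t => psi t - psi a) psi' p h x.
Proof.
apply/funext => t; rewrite /left_integrand /gen_integrand.
by rewrite opprB addrA subrK.
Qed.

Lemma right_integrandE p h x : right_integrand a b psi p h x =
  gen_integrand (fun t => psi b - psi t) psi' p h x.
Proof.
apply/funext => t; rewrite /right_integrand /gen_integrand.
by rewrite (_ : psi b - psi x - (psi b - psi t) = psi t - psi x)//; ring.
Qed.

Lemma left_psi_integralE p h : left_psi_integral a b psi p h =
  gen_integral (fun x => `]a, x[%classic) (fun t => psi t - psi a) psi' p h.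
Proof. by apply/funext => x; rewrite /left_psi_integral left_integrandE. Qed.

Lemma right_psi_integralE p h : right_psi_integral a b psi p h =
  gen_integral (fun x => `]x, b[%classic) (fun t => psi b - psi t) psi' p h.
Proof. by apply/funext => x; rewrite /right_psi_integral right_integrandE. Qed.

Lemma left_psi_integral_definedE p h x : left_psi_integral_defined a b psi p h x =
  gen_defined (fun x => `]a, x[%classic) (fun t => psi t - psi a) psi' p h x.
Proof. by rewrite /left_psi_integral_defined left_integrandE. Qed.

Lemma right_psi_integral_definedE p h x : right_psi_integral_defined a b psi p
  h x =
  gen_defined (fun x => `]x, b[%classic) (fun t => psi b - psi t) psi' p h x.
Proof. by rewrite /right_psi_integral_defined right_integrandE. Qed.

Lemma left_psi_derivenE k h :
  left_psi_deriven a b psi k h = gen_deriven `]a, b]%classic psi' k h.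
Proof. by []. Qed.

Lemma right_psi_derivenE k h :
  right_psi_deriven a b psi k h = gen_deriven `[a, b[%classic (fun t =>
    - psi' t) k h.
Proof.
rewrite /right_psi_deriven /gen_deriven; congr (iter k _ h).
by apply/funext => g; apply/funext => x; rewrite /right_psi_derive /gen_derive
  invrN mulrN.
Qed.

End assembly.

(** The definedness clauses guarantee that the equalities concern integrals and limits that exist,
    not default values of total functions. *)
Theorem theorem7 (R : realType) (a b : R) (hab : a < b)
  (n : nat) (alpha : R) (halpha : 0 < alpha)
  (hn : n%:R - 1 < alpha < n%:R)
  (beta : R) (hbeta : 0 <= beta <= 1)
  (psi : R -> R) (hpsi : Cn_on n `[a, b] psi)
  (hincr : {in `[a, b] &, {homo psi : x y / x < y}})
  (hpsi' : forall x, x \in `[a, b] -> derive_on `[a, b] psi x != 0)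
  (f : R -> R) (hf : Cn_on 1 `[a, b] f) :
  (forall x, x \in `]a, b] ->
     [/\ forall y, y \in `]a, b] -> left_psi_integral_defined a b psi alpha f y,
         left_hilfer_defined a b psi n alpha beta
           (left_psi_integral a b psi alpha f) x
       & left_hilfer a b psi n alpha beta
           (left_psi_integral a b psi alpha f) x = f x]) /\
  (forall x, x \in `[a, b[ ->
     [/\ forall y, y \in `[a, b[ -> right_psi_integral_defined a b psi alpha f y,
         right_hilfer_defined a b psi n alpha beta
           (right_psi_integral a b psi alpha f) x
       & right_hilfer a b psi n alpha beta
           (right_psi_integral a b psi alpha f) x = f x]).
Proof.
have n0 : (0 < n)%N by move: hn => /andP[_ an];
  rewrite -(ltr0n R) (lt_trans halpha).
have [dpsi cpsi] := hpsi.
have {}dpsi x : x \in `[a, b] -> derivable_on `[a, b] psi x by exact: (dpsi 0%N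
  n0).
have cdpsi : {within `[a, b], continuous (derive_on `[a, b] psi)} by
  exact: (cpsi 1%N n0).
have {}cpsi : {within `[a, b], continuous psi} by exact: (cpsi 0%N).
split.
- have cv := psi_change_left hab dpsi cpsi cdpsi hincr hpsi'.
  have [F1 tF1 fE] := primitive_left hab dpsi cpsi cdpsi hincr hpsi' hf.
  move=> x xA; have [defx valx] := gen_hilfer cv halpha hn hbeta tF1 fE xA.
  split.
  + move=> y yA; rewrite left_psi_integral_definedE.
    by have [] := gen_defined_tame cv halpha tF1 fE yA.
  + rewrite /left_hilfer_defined; split.
    * move=> y yA; rewrite left_psi_integral_definedE left_psi_integralE.
      by have [] := gen_integralc cv halpha hn hbeta tF1 fE yA.
    * move=> k kn y yA; rewrite !left_psi_integralE left_psi_derivenE.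
      exact: (gen_derivable cv halpha hn hbeta tF1 fE kn yA).
    * by rewrite !left_psi_integralE left_psi_derivenE left_psi_integral_definedE.
  + by rewrite /left_hilfer !left_psi_integralE left_psi_derivenE.
- have cv := psi_change_right hab dpsi cpsi cdpsi hincr hpsi'.
  have [F1 tF1 fE] := primitive_right hab dpsi cpsi cdpsi hincr hpsi' hf.
  move=> x xA; have [defx valx] := gen_hilfer cv halpha hn hbeta tF1 fE xA.
  split.
  + move=> y yA; rewrite right_psi_integral_definedE.
    by have [] := gen_defined_tame cv halpha tF1 fE yA.
  + rewrite /right_hilfer_defined; split.
    * move=> y yA; rewrite right_psi_integral_definedE right_psi_integralE.
      by have [] := gen_integralc cv halpha hn hbeta tF1 fE yA.
    * move=> k kn y yA; rewrite !right_psi_integralE right_psi_derivenE.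
      exact: (gen_derivable cv halpha hn hbeta tF1 fE kn yA).
    * by rewrite !right_psi_integralE right_psi_derivenE
        right_psi_integral_definedE.
  + by rewrite /right_hilfer !right_psi_integralE right_psi_derivenE.
Qed.
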